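(* For every integer $v\geq 15$ with $v\equiv 0$ or $1 \pmod 5$, there exists a super-simple $(v,5,2)$DD with $d\geq \frac{1}{2}$, i.e. whose smallest defining sets contain at least half of its blocks.
   Context: A $(v,5,2)$ directed design ($(v,5,2)$DD) on a $v$-set $V$ is a collection $\mathcal B$ of blocks, each an ordered $5$-tuple of distinct elements of $V$, such that every ordered pair $(x,y)$ of distinct elements of $V$ is contained in exactly $2$ blocks, where a block $(b_1,\dots,b_5)$ contains the ordered pair $(b_i,b_j)$ whenever $i<j$. Forgetting the order in each block gives the underlying design (a $(v,5,4)$-BIBD). The $(v,5,2)$DD is super-simple if any two blocks of its underlying design intersect in at most two points. A defining set of a $(v,5,2)$DD $(V,\mathcal B)$ is a subset $S\subseteq \mathcal B$ such that $(V,\mathcal B)$ is the unique $(v,5,2)$DD on $V$ whose block collection contains $S$; a smallest defining set is a defining set of minimum cardinality. The quantity $d$ is the number of blocks in a smallest defining set divided by the total number of blocks of the design. *)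

(* Defs.v *)
From mathcomp Require Import all_boot all_order all_algebra.
From mathcomp Require Import finmap multiset boolp.

Set Implicit Arguments.
Unset Strict Implicit.
Unset Printing Implicit Defensive.

Local Open Scope mset_scope.

Section DirectedDesign.
Variable V : finType.

Definition contains_pair (x y : V) (b : 5.-tuple V) : bool :=
  [exists i : 'I_5, exists j : 'I_5, [&& i < j, tnth b i == x & tnth b j == y]].

(* Collections of blocks are multisets, so that a design may a priori have
   repeated blocks; the count below is taken with multiplicity. *)
Definition is_DD (B : {mset 5.-tuple V}) : bool :=
  all (fun b : 5.-tuple V => uniq b) B &&
  [forall x : V, forall y : V,
     (x != y) ==> (count (contains_pair x y) B == 2)].

Record DD := MkDD { blocks :> {mset 5.-tuple V}; _ : is_DD blocks }.

Definition underlying (D : DD) : seq {set V} :=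
  [seq [set x in (b : 5.-tuple V)] | b <- blocks D].

(* [pairwise] compares the entries at any two distinct positions, so two copies
   of the same underlying block count as two blocks. *)
Definition super_simple (D : DD) : bool :=
  pairwise (fun X Y : {set V} => #|X :&: Y| <= 2) (underlying D).

Definition defining_set (D : DD) (S : {mset 5.-tuple V}) : Prop :=
  (S `<=` blocks D) /\
  (forall D' : DD, S `<=` blocks D' -> blocks D' = blocks D).

Definition smallest_defining_set (D : DD) (S : {mset 5.-tuple V}) : Prop :=
  defining_set D S /\
  (forall S' : {mset 5.-tuple V}, defining_set D S' -> size S <= size S').

Lemma perm_msetD (A B : {mset 5.-tuple V}) :
  perm_eq (A `+` B) ((A : seq _) ++ (B : seq _)).
Proof.
by apply/allP => b _ /=; rewrite count_cat !count_mem_mset msetE2.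
Qed.

Lemma defining_set_self (D : DD) : defining_set D (blocks D).
Proof.
split=> [|D' sub]; first exact: msubset_refl.
have eqD := msetBDKC sub.
case: (mset_0Vmem (blocks D' `\` blocks D)) => [E0 | [b bE]].
  by rewrite -eqD E0 msetD0.
have bD' : b \in blocks D'.
  by rewrite -eqD; apply/msetDP; right.
case: D D' sub eqD bE bD' => [B pB] [B' pB'] /= sub eqD bE bD'.
have /andP[_ /forallP hB] := pB; have /andP[/allP uB' /forallP hB'] := pB'.
pose i0 : 'I_5 := ord0; pose i1 : 'I_5 := ord_max.
have ne : tnth b i0 != tnth b i1.
  have /tuple_uniqP inj := uB' _ bD'.
  by apply/eqP => /inj.
have c1 := hB (tnth b i0); have {c1}/eqP c1 := implyP (forallP c1 (tnth b i1)) ne.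
have c2 := hB' (tnth b i0); have {c2}/eqP c2 := implyP (forallP c2 (tnth b i1)) ne.
move: c2; rewrite -eqD (permP (perm_msetD _ _)) count_cat c1 => /eqP.
rewrite -[X in _ == X]addn0 eqn_add2l => /eqP c0.
have : has (contains_pair (tnth b i0) (tnth b i1)) (B' `\` B).
  apply/hasP; exists b => //.
  by apply/existsP; exists i0; apply/existsP; exists i1; rewrite !eqxx.
by rewrite has_count c0.
Qed.

Lemma ex_smallest_defining_set (D : DD) :
  exists S : {mset 5.-tuple V}, smallest_defining_set D S.
Proof.
pose P n := `[< exists2 S, defining_set D S & size S = n >].
have exP : exists n, P n.
  by exists (size (blocks D)); apply/asboolP; exists (blocks D) => //;
     exact: defining_set_self.
case: (ex_minnP exP) => n /asboolP[S dS sS] minn.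
exists S; split=> // S' dS'; rewrite sS; apply: minn.
by apply/asboolP; exists S'.
Qed.

Definition smallest_defining_size (D : DD) : nat :=
  size (projT1 (cid (ex_smallest_defining_set D))).

Lemma smallest_defining_sizeE (D : DD) (S : {mset 5.-tuple V}) :
  smallest_defining_set D S -> size S = smallest_defining_size D.
Proof.
rewrite /smallest_defining_size; case: cid => /= S0 [d0 m0] [d m].
by apply/eqP; rewrite eqn_leq m // m0.
Qed.

Definition defining_ratio (D : DD) : rat :=
  ((smallest_defining_size D)%:R / (size (blocks D))%:R)%R.

End DirectedDesign.

(* Main.v *)
Require Import Defs.
From mathcomp Require Import all_boot all_order all_algebra.
From mathcomp Require Import finmap multiset boolp.
From Stdlib Require Import NArith Lia.
From mathcomp Require Import zify.

(** If a block [b] has the consecutive points [x, y] and a block [c] has the consecutive points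
    [y, x], exchanging them in both blocks yields another directed design, so every defining
    set contains [b] or [c].  If [b |-> c] can be chosen to be a permutation of the blocks of a
    super-simple design, a defining set therefore contains at least half of the blocks.  Such
    permutations, and super-simplicity, survive gluing along pairwise disjoint sets of pairs:
    two blocks from different pieces share at most one point.

    For [v = 5 n + e] with [e] in [{0, 1}], a transversal design TD(8, m) with its last three
    columns truncated to [a, b, c] points gives, after multiplying points by 5, replacing lines
    by group divisible designs of type 5^k (5 <= k <= 8), and filling the columns together with
    [e] points at infinity, the value [n = 5 m + a + b + c] from [m, a, b, c].  The lines
    over Z/m serve when m is prime to 30, which leaves [n = 57] (the field with nine elements)
    and [n < 38].  There, 25, 28, 29, 30 come from TD(6, 5) and 35 from TD(8, 7); the other
    values come from designs found by computer, which are cyclic, 1-rotational, or cyclic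
    group divisible with one group of fixed points, the groups being filled recursively. *)

Set Implicit Arguments.
Unset Strict Implicit.
Unset Printing Implicit Defensive.
Set Bullet Behavior "Strict Subproofs".

Import Order.TTheory GRing.Theory Num.Theory.
Local Open Scope mset_scope.

(** * Collections of blocks matched by swap trades *)

(** Adjacency is what makes the trade work: exchanging two consecutive points reverses the pair they
    form and no other, so [b] turns (x, y) into (y, x), [c] does the opposite, and the total
    coverage is unchanged.

    Small groups are the obstacle of the recursion. Super-simplicity puts every triple in at most
    one block; a design on v > 1 points has v(v-1)/5 blocks, hence 2v(v-1) distinct triples out of
    v(v-1)(v-2)/6, which forces v >= 14. So n = 1 and n = 2 are impossible, and a truncated column
    may have 0 points or at least 3, never 1 or 2. From m one therefore cannot reach 5m + 1 or 5m +
    2. This is why 57 stands apart: it is 5 * 11 + 2, and it exceeds 8 * 7 = 56.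

    The number 30 comes from the eight columns: seven of them are indexed by 0, ..., 6, and their
    differences 1, ..., 6 must be invertible modulo m. *)

Fixpoint pairs_of (T : Type) (s : seq T) : seq (T * T) :=
  if s is x :: s' then [seq (x, y) | y <- s'] ++ pairs_of s' else [::].

Definition consecutive (T : Type) (s : seq T) : seq (T * T) := zip s (behead s).

Definition swap_mates (T : eqType) (b c : seq T) : bool :=
  has (fun e => (e.2, e.1) \in consecutive c) (consecutive b).

Definition meet_le2 (T : eqType) (b c : seq T) : bool := count [in c] b <= 2.

Definition covers (T : eqType) (e : T * T) (B : seq (seq T)) : nat :=
  count_mem e (flatten [seq pairs_of b | b <- B]).

(* [C] is a reordering of [B] in which every block of [B] is matched with a block sharing
   a swap trade with it; the matching may be any permutation, not only an involution. *)
Definition good (T : eqType) (P : rel T) : Prop :=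
  exists B C : seq (seq T),
    [/\ all (fun b => (size b == 5) && uniq b) B,
        forall x y, x != y -> covers (x, y) B = (P x y).*2,
        pairwise (@meet_le2 T) B, perm_eq C B & all2 (@swap_mates T) B C].

Section Pairs.
Variable T : eqType.
Implicit Types (s b : seq T) (x y : T).

Lemma map_pairs_of (U : Type) (f : T -> U) s :
  pairs_of (map f s) = [seq (f e.1, f e.2) | e <- pairs_of s].
Proof.
by elim: s => //= x s IH; rewrite map_cat IH -!map_comp.
Qed.

Lemma consecutive_map (U : Type) (f : T -> U) s :
  consecutive (map f s) = [seq (f e.1, f e.2) | e <- consecutive s].
Proof. by case: s => //= x s; rewrite /consecutive /=; elim: s x => //= y s IH x; rewrite IH. Qed.

Lemma pairs_of_mem s x y : (x, y) \in pairs_of s -> x \in s /\ y \in s.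
Proof.
elim: s => //= z s IH; rewrite mem_cat => /orP[/mapP[w ws [-> ->]]|/IH[xs ys]].
  by rewrite !inE eqxx ws orbT.
by rewrite !inE xs ys !orbT.
Qed.

Lemma mem_pairs_of s x y : x \in s -> y \in s -> x != y ->
  ((x, y) \in pairs_of s) || ((y, x) \in pairs_of s).
Proof.
elim: s => //= z s IH; rewrite !inE !mem_cat => /orP[/eqP->|xs] /orP[/eqP->|ys].
- by rewrite eqxx.
- by move=> _; rewrite (map_f (fun y => (z, y)) ys).
- by move=> _; rewrite (map_f (fun y => (z, y)) xs) orbT.
- by move=> /(IH xs ys) /orP[->|->]; rewrite !orbT.
Qed.

Lemma coversE e (B : seq (seq T)) : covers e B = \sum_(b <- B) count_mem e (pairs_of b).
Proof. by rewrite /covers count_flatten -map_comp sumnE big_map. Qed.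

Lemma covers_cat e (B1 B2 : seq (seq T)) : covers e (B1 ++ B2) = covers e B1 + covers e B2.
Proof. by rewrite !coversE big_cat. Qed.

Lemma covers_perm e (B1 B2 : seq (seq T)) : perm_eq B1 B2 -> covers e B1 = covers e B2.
Proof. by move=> p; rewrite !coversE; apply: perm_big. Qed.

Lemma covers_gt0 e (B : seq (seq T)) b : b \in B -> e \in pairs_of b -> 0 < covers e B.
Proof.
move=> bB eb; rewrite -has_count has_pred1.
by apply/flattenP; exists (pairs_of b); rewrite ?map_f.
Qed.

Lemma count_mem2P (b c : seq T) : uniq b ->
  reflect (exists x y, [/\ x != y, x \in b, y \in b, x \in c & y \in c])
    (1 < count [in c] b).
Proof.
move=> ub; rewrite -size_filter.
apply: (iffP idP) => [|[x [y [xy xb yb xc yc]]]].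
  case E: (filter _ _) => [|x [|y s]] // _; exists x, y.
  have u := filter_uniq [in c] ub; rewrite E in u.
  have /[!mem_filter]/andP[xc xb]: x \in [seq x <- b | x \in c] by rewrite E mem_head.
  have /[!mem_filter]/andP[yc yb]: y \in [seq x <- b | x \in c] by rewrite E !inE eqxx orbT.
  by split=> //; case/andP: u; rewrite inE negb_or => /andP[].
have: uniq [:: x; y] by rewrite /= inE xy.
move=> /uniq_leq_size; apply=> z; rewrite !inE mem_filter.
by case/orP => /eqP->; rewrite ?xb ?xc ?yb ?yc.
Qed.

End Pairs.

Lemma swap_mates_map (T U : eqType) (f : T -> U) b c :
  swap_mates b c -> swap_mates (map f b) (map f c).
Proof.
case/hasP => -[x y] xyb xyc; apply/hasP; exists (f x, f y).
  by rewrite consecutive_map (map_f (fun e => (f e.1, f e.2)) xyb).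
by rewrite consecutive_map (map_f (fun e => (f e.1, f e.2)) xyc).
Qed.

(** * Gluing and transporting matched collections *)

Section Good.
Variable T : eqType.
Implicit Types (P Q : rel T) (b c : seq T) (B C : seq (seq T)).

Lemma eq_good P Q : (forall x y, x != y -> P x y = Q x y) -> good P -> good Q.
Proof.
move=> PQ [B [C [h1 h2 h3 h4 h5]]]; exists B, C; split=> // x y xy.
by rewrite h2 // PQ.
Qed.

Lemma good_pred0 : good (fun _ _ : T => false).
Proof. by exists [::], [::]; split. Qed.

Lemma swap_mates_cat B1 B2 C1 C2 : all2 (@swap_mates T) B1 C1 -> all2 (@swap_mates T) B2 C2 ->
  all2 (@swap_mates T) (B1 ++ B2) (C1 ++ C2).
Proof.
by elim: B1 C1 => [|b B1 IH] [|c C1] //= /andP[-> h] h2; apply: IH.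
Qed.

(** Two points shared by a block of each piece would form a pair belonging to both relations. The
    two blocks may list these points in opposite orders, which is where symmetry enters. *)
Lemma good_union P Q : symmetric P -> symmetric Q ->
  (forall x y, x != y -> ~~ (P x y && Q x y)) ->
  good P -> good Q -> good (fun x y => P x y || Q x y).
Proof.
move=> sP sQ dPQ [B1 [C1 [a1 c1 m1 p1 s1]]] [B2 [C2 [a2 c2 m2 p2 s2]]].
exists (B1 ++ B2), (C1 ++ C2); split.
- by rewrite all_cat a1.
- move=> x y xy; rewrite covers_cat c1 // c2 //.
  by have := dPQ _ _ xy; case: (P x y); case: (Q x y).
- rewrite pairwise_cat m1 m2 !andbT; apply/allrelP => b c bB cB.
  rewrite /meet_le2 leqNgt; apply/negP => lt2.
  have /andP[_ ub] := allP a1 _ bB.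
  have /(count_mem2P _ ub)[x [y [xy xb yb xc yc]]] : 1 < count [in c] b by apply: leq_trans lt2.
  have yx : y != x by rewrite eq_sym.
  have PP : P x y.
    case/orP: (mem_pairs_of xb yb xy) => /(covers_gt0 bB); rewrite c1 //; first by case: (P x y).
    by rewrite sP; case: (P x y).
  have QQ : Q x y.
    case/orP: (mem_pairs_of xc yc xy) => /(covers_gt0 cB); rewrite c2 //; first by case: (Q x y).
    by rewrite sQ; case: (Q x y).
  by have := dPQ _ _ xy; rewrite PP QQ.
- by rewrite perm_cat.
- exact: swap_mates_cat.
Qed.

Lemma good_bigcup (I : eqType) (r : seq I) (F : I -> rel T) :
  uniq r -> {in r, forall i, symmetric (F i)} ->
  (forall x y i j, x != y -> i \in r -> j \in r -> F i x y -> F j x y -> i = j) ->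
  {in r, forall i, good (F i)} ->
  good (fun x y => has (fun i => F i x y) r).
Proof.
elim: r => [|i r IH] /=; first by move=> *; exact: good_pred0.
move=> /andP[ir ur] sF dF gF.
apply: good_union.
- by apply: sF; rewrite mem_head.
- by move=> x y; apply: eq_in_has => j jr; apply: sF; rewrite inE jr orbT.
- move=> x y xy; apply/negP => /andP[Fi /hasP[j jr Fj]].
  have E : i = j by apply: (dF x y) => //; rewrite inE ?eqxx ?jr ?orbT.
  by rewrite E jr in ir.
- by apply: gF; rewrite mem_head.
- apply: IH => // [j jr|x y j k xy jr kr|j jr].
  + by apply: sF; rewrite inE jr orbT.
  + by apply: dF; rewrite // inE ?jr ?kr orbT.
  + by apply: gF; rewrite inE jr orbT.
Qed.

End Good.

(** Injectivity on [D] is enough because all points of blocks lie in [D]: any point of a block forms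
    a covered pair with another point of it, and covered pairs satisfy [P]. The last hypothesis on
    [Q] ensures that no pair outside the image has to be covered. *)
Lemma good_image (T U : eqType) (D : {pred T}) (f : T -> U) (P : rel T) (Q : rel U) :
  {in D &, injective f} ->
  (forall x y, P x y -> (x \in D) && (y \in D)) ->
  {in D &, forall x y, x != y -> Q (f x) (f y) = P x y} ->
  (forall u w, u != w -> Q u w ->
     exists x y, [/\ x \in D, y \in D, u = f x & w = f y]) ->
  good P -> good Q.
Proof.
move=> fI PD QP Qf [B [C [a cv m p s]]].
have BD b : b \in B -> {subset b <= D}.
  move=> bB x xb; have /andP[/eqP sb ub] := allP a _ bB.
  have [y yb yx] : exists2 y, y \in b & y != x.
    have : has (predC1 x) b.
      rewrite has_predC all_count sb; apply/negP => /eqP E.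
      by have := count_uniq_mem x ub; rewrite E; case: (x \in b).
    by case/hasP => y; exists y.
  have xy : x != y by rewrite eq_sym.
  have : P x y || P y x.
    case/orP: (mem_pairs_of xb yb xy) => /(covers_gt0 bB); rewrite cv //; case: (P _ _) => //.
    by rewrite orbT.
  by case/orP => /PD/andP[].
have fIb b : b \in B -> {in b &, injective f}.
  by move=> bB x y xb yb; apply: fI; apply: BD bB _ _.
have CB c : c \in C -> c \in B by rewrite (perm_mem p).
exists (map (map f) B), (map (map f) C); split.
- apply/allP => _ /mapP[b bB ->]; have /andP[sb ub] := allP a _ bB.
  by rewrite size_map sb map_inj_in_uniq //; apply: fIb.
- have cvE e : e.1 \in D -> e.2 \in D -> covers (f e.1, f e.2) (map (map f) B) = covers e B.
    move=> e1 e2; rewrite !coversE big_map big_seq [RHS]big_seq; apply: eq_bigr => b bB.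
    rewrite map_pairs_of count_map; apply: eq_in_count => [[x y]] /= /pairs_of_mem[xb yb].
    case: e e1 e2 => e1 e2 /= h1 h2; apply/eqP/eqP => [[E1 E2] | [-> ->] //].
    by congr (_, _); [apply: fI E1 | apply: fI E2] => //; apply: (BD b).
  move=> u w uw; case E: (Q u w).
    have [x [y [xD yD ux wy]]] := Qf _ _ uw E.
    have xy : x != y by apply: contraNneq uw => xy; rewrite ux wy xy.
    by rewrite ux wy (cvE (x, y)) // cv // -QP // -ux -wy E.
  apply/eqP; rewrite -leqn0 leqNgt; apply/negP; rewrite -has_count has_pred1.
  case/flattenP => _ /mapP[_ /mapP[b bB ->] ->].
  rewrite map_pairs_of => /mapP[[x y] xyb] /= [ux wy].
  have [xb yb] := pairs_of_mem xyb.
  have xD := BD _ bB _ xb; have yD := BD _ bB _ yb.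
  have xy : x != y by apply: contraNneq uw => xy; rewrite ux wy xy.
  by have := covers_gt0 bB xyb; rewrite cv // -QP // -ux -wy E.
- rewrite pairwise_map; apply: (sub_in_pairwise (P := mem B)) m => [b c bB cB|]; last exact: allss.
  rewrite /= /meet_le2 count_map; apply: leq_trans; apply/eq_leq.
  apply: eq_in_count => x xb /=; apply/mapP/idP => [[y yc /fI ->] //|xc]; last by exists x.
    exact: (BD b).
  exact: (BD c).
- by rewrite perm_map.
- elim: B C s {p a cv m BD fIb CB} => [|b B IH] [|c C] //= /andP[h /IH ->]; rewrite andbT.
  exact: swap_mates_map.
Qed.

Section Pairwise.
Variables (T : eqType) (r : rel T).

(** Together with [in_pairwise] this frees a symmetric condition from the order of the list, so that
    it passes to the enumeration chosen by a multiset. *)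
Lemma pairwise_in s : {in s &, symmetric r} -> pairwise r s ->
  {in s &, forall x y, x != y -> r x y}.
Proof.
elim: s => //= z s IH sr /andP[/allP rz rs] x y xzs yzs; move: (xzs) (yzs); rewrite !inE.
case/orP => [/eqP->|xs] /orP[/eqP->|ys] xy.
- by rewrite eqxx in xy.
- exact: rz.
- by rewrite sr ?mem_head //; apply: rz.
- by apply: IH => // u w us ws; apply: sr; rewrite inE ?us ?ws orbT.
Qed.

Lemma in_pairwise s : uniq s -> {in s &, forall x y, x != y -> r x y} -> pairwise r s.
Proof.
elim: s => //= z s IH /andP[zs us] h; apply/andP; split.
  by apply/allP => x xs; apply: h; rewrite ?inE ?eqxx ?xs ?orbT //; apply: contraNneq zs => ->.
by apply: IH => // x y xs ys; apply: h; rewrite inE ?xs ?ys orbT.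
Qed.
End Pairwise.

(** * Exchanging two adjacent points of a block *)

Section PairsOf.
Variable T : eqType.
Implicit Types (s b : seq T).

Lemma pairs_of_uniq s : uniq s -> uniq (pairs_of s).
Proof.
elim: s => //= x s IH /andP[xs us]; rewrite cat_uniq IH // andbT.
rewrite map_inj_uniq ?us //=; last by move=> y z [].
apply/hasPn => -[y z] /pairs_of_mem[ys _]; apply/mapP => -[w _ [yx _]].
by rewrite -yx ys in xs.
Qed.

Lemma pairs_of_nth x0 x y s :
  (x, y) \in pairs_of s <->
  exists i j, [/\ i < j, j < size s, nth x0 s i = x & nth x0 s j = y].
Proof.
elim: s => [|z s IH] /=; first by split=> // -[i [j []]].
rewrite mem_cat; split.
- case/orP => [/mapP[w ws [-> ->]]|/IH[i [j [ij js xi yj]]]].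
    by exists 0, (index w s).+1; split; rewrite //= ?ltnS ?index_mem ?nth_index.
  by exists i.+1, j.+1.
- move=> [[|i] [[|j] [ij js xi yj]]] //; last by apply/orP; right; apply/IH; exists i, j.
  by rewrite /= in xi yj; rewrite xi -yj map_f ?mem_nth.
Qed.

Lemma meet_le2_sym b c : uniq b -> uniq c -> meet_le2 b c = meet_le2 c b.
Proof.
move=> ub uc; rewrite /meet_le2 -!size_filter.
congr (_ <= _); apply/perm_size/uniq_perm; rewrite ?filter_uniq //.
by move=> x; rewrite !mem_filter andbC.
Qed.

Lemma consecutiveP x y s :
  (x, y) \in consecutive s -> exists s1 s2, s = s1 ++ x :: y :: s2.
Proof.
elim: s => [|z [|w s] IH] //=; rewrite inE => /orP[/eqP[-> ->]|/IH[s1 [s2 E]]].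
  by exists [::], s.
by exists (z :: s1), s2; rewrite E.
Qed.

Lemma count_pairs_of_cat (p : pred (T * T)) s1 s2 :
  count p (pairs_of (s1 ++ s2)) =
  count p (pairs_of s1) + count p (pairs_of s2) + count p [seq (x, y) | x <- s1, y <- s2].
Proof.
elim: s1 => [|x s1 IH]; first by rewrite /= addn0.
by rewrite /= map_cat !count_cat IH; lia.
Qed.

(** Every other entry stands on the same side of both [x] and [y], so only the pair they form is
    reversed. The terms are balanced on both sides to avoid subtraction. *)
Lemma count_pairs_of_swap (p : pred (T * T)) s1 x y s2 :
  p (y, x) + count p (pairs_of (s1 ++ x :: y :: s2)) =
  p (x, y) + count p (pairs_of (s1 ++ y :: x :: s2)).
Proof.
have E : count p [seq (u, w) | u <- s1, w <- x :: y :: s2]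
         = count p [seq (u, w) | u <- s1, w <- y :: x :: s2].
  by elim: s1 => //= a s IH; rewrite !count_cat IH; lia.
by rewrite !count_pairs_of_cat E /= !count_cat /=; lia.
Qed.

End PairsOf.

Section Design.
Variable V : finType.
Implicit Types (b c : 5.-tuple V) (B C : seq (5.-tuple V)).

Lemma contains_pairE x y b : contains_pair x y b = ((x, y) \in pairs_of b).
Proof.
apply/existsP/idP.
- move=> [i /existsP[j /and3P[ij /eqP xi /eqP yj]]].
  by apply/(pairs_of_nth x); exists i, j; rewrite size_tuple -!tnth_nth; split.
- move/(pairs_of_nth x) => [i [j [ij]]]; rewrite size_tuple => js xi yj.
  exists (Ordinal (ltn_trans ij js)); apply/existsP; exists (Ordinal js).
  by rewrite !(tnth_nth x) /= xi yj ij !eqxx.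
Qed.

Lemma count_contains_pair x y B : all (fun b : 5.-tuple V => uniq b) B ->
  count (contains_pair x y) B = covers (x, y) (map val B).
Proof.
rewrite coversE big_map; elim: B => [|b B IH] /=; first by rewrite big_nil.
move=> /andP[ub /IH ->]; rewrite big_cons contains_pairE.
by rewrite count_uniq_mem // pairs_of_uniq.
Qed.

Lemma seq_of_tuples (A : seq (seq V)) : all (fun b : seq V => size b == 5) A ->
  exists B, map val B = A.
Proof.
elim: A => [|b A IH] /=; first by exists [::].
by move=> /andP[sb /IH[B <-]]; exists (Tuple sb :: B).
Qed.

Lemma is_DD_seq_mset B : all (fun b : 5.-tuple V => uniq b) B ->
  (forall x y, x != y -> covers (x, y) (map val B) = 2) -> is_DD (seq_mset B).
Proof.
move=> uB cB; rewrite /is_DD (perm_all _ (perm_eq_seq_mset B)) uB /=.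
apply/forallP => x; apply/forallP => y; apply/implyP => xy.
by rewrite (permP (perm_eq_seq_mset B)) count_contains_pair // cB.
Qed.

(* [b'] and [c'] are obtained from [b = .. x y ..] and [c = .. y x ..] by exchanging the two
   consecutive points in both. *)
Lemma swap_block (b c : 5.-tuple V) : swap_mates b c -> uniq b -> uniq c ->
  exists b' c' : 5.-tuple V,
    [/\ uniq b', uniq c', b' != b /\ b' =i b, b != c &
     forall e, count_mem e (pairs_of b') + count_mem e (pairs_of c') =
               count_mem e (pairs_of b) + count_mem e (pairs_of c)].
Proof.
move=> /hasP[[x y] /consecutiveP[s1 [s2 Eb]] /consecutiveP[t1 [t2 /= Ec]]] ub uc.
have pc (z w : V) (u1 u2 : seq V) : perm_eq (u1 ++ w :: z :: u2) (u1 ++ z :: w :: u2).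
  by apply/permP => p; rewrite !count_cat /=; lia.
have sb : size (s1 ++ y :: x :: s2) == 5 by rewrite (perm_size (pc _ _ _ _)) -Eb size_tuple.
have sc : size (t1 ++ x :: y :: t2) == 5 by rewrite (perm_size (pc _ _ _ _)) -Ec size_tuple.
exists (Tuple sb), (Tuple sc); split => /=.
- by rewrite (perm_uniq (pc _ _ _ _)) -Eb.
- by rewrite (perm_uniq (pc _ _ _ _)) -Ec.
- split; last by move=> z; have := perm_mem (pc x y s1 s2) z; rewrite -Eb.
  apply: contraTneq ub => /(congr1 val) /=; rewrite Eb => /eqP.
  rewrite eqseq_cat // => /andP[_ /eqP[-> _]]; rewrite cat_uniq /= inE eqxx.
  by rewrite !andbF.
(* A block without repetition cannot contain both (x, y) and (y, x). *)
- apply: contraTneq ub => bc; rewrite Eb.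
  have m1 : (x, y) \in pairs_of b.
    rewrite -has_pred1 has_count Eb count_pairs_of_cat /= !count_cat /= eqxx; lia.
  have m2 : (y, x) \in pairs_of b.
    rewrite bc -has_pred1 has_count Ec count_pairs_of_cat /= !count_cat /= eqxx; lia.
  apply/negP; rewrite -Eb => ub.
  move/(pairs_of_nth x): m1 => [i [j [ij js xi yj]]].
  move/(pairs_of_nth x): m2 => [i' [j' [ij' js' yi' xj']]].
  have si := ltn_trans ij js; have si' := ltn_trans ij' js'.
  have E1 : i = j' by apply/eqP; rewrite -(nth_uniq x si js' ub) xi xj'.
  have E2 : j = i' by apply/eqP; rewrite -(nth_uniq x js si' ub) yj yi'.
  by move: ij ij'; rewrite E1 E2; lia.
- move=> e; rewrite Eb Ec.
  have := count_pairs_of_swap (pred1 e) s1 x y s2.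
  have := count_pairs_of_swap (pred1 e) t1 y x t2.
  by rewrite /=; lia.
Qed.
End Design.

(** * From matched collections to designs *)

Lemma size_le_count_all2 (T : eqType) (r : rel T) (p : pred T) (s t : seq T) :
  all2 r s t -> {in s & t, forall x y, r x y -> p x || p y} ->
  size s <= count p s + count p t.
Proof.
elim: s t => [|x s IH] [|y t] //= /andP[xy st] h.
have : {in s & t, forall x y, r x y -> p x || p y}.
  by move=> u w us wt; apply: h; rewrite inE ?us ?wt orbT.
move=> /(IH t st); have := h x y (mem_head _ _) (mem_head _ _) xy.
by case: (p x); case: (p y) => //=; lia.
Qed.

Section Lower.
Variable V : finType.
Implicit Types (B C S : seq (5.-tuple V)).

(** If [S] missed a block [b] and its mate [c], the traded design would still contain [S] and hence
    equal [D]; but it has a block with the five points of [b] in another order, which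
    super-simplicity excludes. So [S] meets every matched pair, and since [C] reorders [B], each
    block of [S] is counted twice. *)
Lemma swap_lower B C (D : DD V) (S : {mset 5.-tuple V}) :
  blocks D = seq_mset B -> all (fun b : 5.-tuple V => uniq b) B ->
  pairwise (fun b c : 5.-tuple V => meet_le2 b c) B -> uniq B ->
  (forall x y, x != y -> covers (x, y) (map val B) = 2) ->
  perm_eq C B -> all2 (fun b c : 5.-tuple V => swap_mates b c) B C ->
  defining_set D S -> size B <= (size S).*2.
Proof.
move=> DE uB mB uniB cB pCB sBC [SD defS].
have inS (b c : 5.-tuple V) : swap_mates b c -> b \in B -> c \in B -> (b \in S) || (c \in S).
  move=> bc bB cB'; rewrite -[_ || _]negbK negb_or; apply/negP => /andP[bS cS].
  have [b' [c' [ub' uc' [nb' Eb'] nbc cnt]]] := swap_block bc (allP uB _ bB) (allP uB _ cB').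
  pose B1 := rem b (rem c B).
  have pB : perm_eq B (c :: b :: B1).
    rewrite (permPl (perm_to_rem cB')) perm_cons perm_to_rem //.
    by rewrite mem_rem_uniq // inE nbc.
  pose B' := [:: b', c' & B1].
  have uB' : all (fun b : 5.-tuple V => uniq b) B'.
    by move: uB; rewrite (perm_all _ pB) /= ub' uc' => /and3P[].
  have cB1 x y : x != y -> covers (x, y) (map val B') = 2.
    move=> xy; have := cB _ _ xy; rewrite (covers_perm _ (perm_map val pB)) !coversE /= !big_cons.
    move=> h; rewrite addnA; apply: etrans h.
    apply: etrans (congr1 (addn^~ _) (cnt (x, y))) _.
    by rewrite -addnA addnCA.
  pose D' := MkDD (is_DD_seq_mset uB' cB1).
  have SD' : msubset S (blocks D').
    apply/msubsetP => z; rewrite /= mset_seqE /=.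
    have := msubsetP SD z; rewrite DE mset_seqE (permP pB) /=.
    case: (eqVneq c z) => [<- _|_]; first by move/count_memPn: cS; rewrite count_mem_mset => ->.
    case: (eqVneq b z) => [<- _|_]; first by move/count_memPn: bS; rewrite count_mem_mset => ->.
    by move/leq_trans; apply; rewrite !add0n addnA leq_addl.
  have /(congr1 (fun M : {mset _} => b' \in M)) := defS D' SD'.
  rewrite DE /= !(perm_mem (perm_eq_seq_mset _)) mem_head => /esym b'B.
  have symB : {in B &, symmetric (fun b c : 5.-tuple V => meet_le2 b c)}.
    by move=> p q ? ?; rewrite meet_le2_sym ?(allP uB).
  have := pairwise_in symB mB b'B bB nb'; rewrite /meet_le2.
  have -> : count [in b] b' = size b'.
    by apply/eqP; rewrite -all_count; apply/allP => z; rewrite -Eb'.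
  by rewrite size_tuple.
have := size_le_count_all2 sBC (p := [in S]) => /(_ _)/wrap[b c bB cC bc|].
  by apply: inS bc bB _; rewrite -(perm_mem pCB).
rewrite (permP pCB) addnn => /leq_trans; apply; rewrite leq_double.
rewrite -size_filter; apply: uniq_leq_size; first exact: filter_uniq.
by move=> b; rewrite mem_filter => /andP[].
Qed.

(** The two distinct points force at least one block, so the denominator of the ratio is nonzero. *)
Lemma good_design (x0 y0 : V) : x0 != y0 -> good (fun x y : V => x != y) ->
  exists D : DD V, super_simple D /\ (1 / 2 <= defining_ratio D :> rat)%R.
Proof.
move=> xy0 [B0 [C0 [/allP aB c0 m0 p0 s0]]].
have [B EB] : exists B, map val B = B0.
  by apply: seq_of_tuples; apply/allP => b /aB /andP[].
have [C EC] : exists C, map val C = C0.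
  by apply: seq_of_tuples; apply/allP => b; rewrite (perm_mem p0) => /aB /andP[].
have uB : all (fun b : 5.-tuple V => uniq b) B.
  by apply/allP => b bB; have /aB/andP[] : val b \in B0 by rewrite -EB map_f.
have cB x y : x != y -> covers (x, y) (map val B) = 2 by move=> xy; rewrite EB c0 // xy.
have mB : pairwise (fun b c : 5.-tuple V => meet_le2 b c) B by rewrite -EB pairwise_map in m0.
have pCB : perm_eq C B by apply: (@perm_map_inj _ _ _ (@val_inj _ _ (5.-tuple V))); rewrite EC EB.
have sBC : all2 (fun b c : 5.-tuple V => swap_mates b c) B C.
  by move: s0; rewrite -EB -EC; elim: (B) (C) => [|b B' IH] [|c C'] //= /andP[-> /IH].
(* A block meets itself in five points, so [mB] forbids repeated blocks. *)
have uniB : uniq B.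
  rewrite uniq_pairwise; apply: sub_pairwise mB => b c; rewrite /meet_le2.
  apply: contraTneq => ->.
  have /eqP -> : count [in c] c == size c by rewrite -all_count allss.
  by rewrite size_tuple.
pose D := MkDD (is_DD_seq_mset uB cB).
exists D; split.
(* The multiset may enumerate its blocks in another order than [B], so the condition goes through
   its order-free form. *)
- rewrite /super_simple /underlying pairwise_map; apply: in_pairwise.
    by rewrite (perm_uniq (perm_eq_seq_mset B)).
  move=> b c; rewrite !(perm_mem (perm_eq_seq_mset B)) => bB cB' bc.
  have meetE (u w : 5.-tuple V) : u \in B -> #|[set x in u] :&: [set x in w]| = count [in w] u.
    move=> uuB; rewrite -size_filter cardE.
    apply/perm_size/uniq_perm; rewrite ?enum_uniq ?filter_uniq ?(allP uB) // => z.
    by rewrite mem_enum !inE mem_filter andbC.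
  rewrite /= meetE //; apply: (pairwise_in _ mB) => // p q ? ?.
  by rewrite meet_le2_sym ?(allP uB).
- rewrite /defining_ratio.
  have [S sS] := ex_smallest_defining_set D.
  rewrite -(smallest_defining_sizeE sS).
  have := swap_lower (erefl : blocks D = seq_mset B) uB mB uniB cB pCB sBC sS.1.
  rewrite /= (perm_size (perm_eq_seq_mset _)) => le.
  have : 0 < size B.
    by have := cB _ _ xy0; rewrite /covers; case: (B).
  move=> gt0; rewrite ler_pdivlMr ?ltr0n // mulrAC mul1r ler_pdivrMr ?ltr0n //.
  by rewrite -natrM ler_nat muln2.
Qed.
End Lower.

(** * Filling groups and truncated transversal designs *)

(** Working over [nat] lets the recursion pass between orders without casts between finite types. *)
Definition good_order (v : nat) : Prop := good (fun x y : nat => (x < v) && (y < v)).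

Definition good_gdd (k : nat) : Prop :=
  good (fun p q : nat * nat => [&& p.1 < k, p.2 < 5, q.1 < k, q.2 < 5 & p.1 != q.1]).

Lemma good_on_seq (T : eqType) (L : seq T) : uniq L ->
  good_order (size L) -> good (fun x y => (x \in L) && (y \in L)).
Proof.
case: L => [|x0 L'] uL; first by move=> _; apply: eq_good (good_pred0 T) => x y.
set L := x0 :: L' in uL *.
apply: (good_image (D := gtn (size L)) (f := nth x0 L)).
- move=> i j; rewrite !inE => si sj /eqP; by rewrite nth_uniq // => /eqP.
- by move=> i j /andP[]; rewrite !inE => -> ->.
- move=> i j si sj _; have [si' sj'] : i < size L /\ j < size L by [].
  by rewrite !mem_nth // si' sj'.
- move=> x y _ /andP[xL yL]; exists (index x L), (index y L).
  by rewrite !inE !index_mem !nth_index.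
Qed.

Lemma good_order_seq (T : eqType) (L : seq T) : uniq L ->
  good (fun x y => (x \in L) && (y \in L)) -> good_order (size L).
Proof.
case: L => [|x0 L'] uL; first by move=> _; apply: eq_good (good_pred0 nat) => x y.
set L := x0 :: L' in uL *.
apply: (good_image (D := [in L]) (f := index^~ L)).
- by move=> x y xL yL /(congr1 (nth x0 L)); rewrite !nth_index.
- by [].
- by move=> x y xL yL _; rewrite !index_mem xL yL.
- move=> i j _ /andP[si sj]; exists (nth x0 L i), (nth x0 L j).
  by split; rewrite ?index_uniq //; apply: mem_nth.
Qed.

(* [e] says whether one point at infinity is added to all the groups before filling them. *)
Lemma good_fill (A K : eqType) (L : seq A) (g : A -> K) (e : bool) : uniq L ->
  good (fun x y => [&& x \in L, y \in L & g x != g y]) ->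
  (forall a, a \in L -> good_order (count [pred x | g x == g a] L + e)) ->
  good_order (size L + e).
Proof.
move=> uL gddL fillL.
(* [None] is the point at infinity, present exactly when [e] is true. *)
pose ext (s : seq A) : seq (option A) := map Some s ++ nseq e None.
have sz s : size (ext s) = size s + e by rewrite size_cat size_map size_nseq.
have Some_inj : injective (@Some A) by move=> x y [].
have mem_ext s x : (x \in ext s) = if x is Some a then a \in s else e.
  rewrite mem_cat mem_nseq; case: x => [a|]; first by rewrite mem_map // andbF orbF.
  by rewrite eqxx andbT lt0b; case: mapP => // -[].
have uniq_ext s : uniq s -> uniq (ext s).
  move=> us; rewrite cat_uniq map_inj_uniq // us /=; apply/andP; split; last by case: (e).
  by rewrite -all_predC; apply/allP => x /nseqP[-> _] /=; apply/mapP => -[].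
rewrite -sz; apply: good_order_seq (uniq_ext _ uL) _.
pose group (h : K) := ext [seq x <- L | g x == h].
pose P (x y : option A) := match x, y with
  | Some a, Some b => [&& a \in L, b \in L & g a != g b] | _, _ => false end.
pose Q (h : K) (x y : option A) := (x \in group h) && (y \in group h).
have memG h x : (x \in group h) = if x is Some a then (g a == h) && (a \in L) else e.
  by rewrite mem_ext; case: x => // a; rewrite mem_filter.
have goodP : good P.
{ apply: (good_image (D := [in L]) (f := Some)) gddL => //.
  - by move=> x y _ _ [].
  - by move=> x y /and3P[xL yL _]; apply/andP.
  - by move=> [a|] [b|] _ //= /and3P[aL bL _]; exists a, b.
}
(* Two filled groups share at most [None], so no pair of distinct points lies in both. *)
have goodQ : good (fun x y => has (fun h => Q h x y) (undup (map g L))).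
{ apply: good_bigcup.
  - exact: undup_uniq.
  - by move=> h _ x y; rewrite /Q andbC.
  - move=> [a|] [b|] h h' // _ _ _; rewrite /Q !memG.
    + by move=> /andP[/andP[/eqP<- _] _] /andP[/andP[/eqP<- _] _].
    + by move=> /andP[/andP[/eqP<- _] _] /andP[/andP[/eqP<- _] _].
    + by move=> /andP[_ /andP[/eqP<- _]] /andP[_ /andP[/eqP<- _]].
  - move=> h; rewrite mem_undup => /mapP[a aL ->].
    apply: good_on_seq; first by apply: uniq_ext; rewrite filter_uniq.
    by rewrite sz size_filter; apply: fillL.
}
apply: eq_good (good_union _ _ _ goodP goodQ).
- move=> x y xy; rewrite !mem_ext; apply/orP/andP.
  + case; first by case: x y xy => [a|] [b|] // _ /and3P[-> ->].
    case/hasP => h _ /andP[]; rewrite !memG.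
    by case: x y xy => [a|] [b|] // _ => [/andP[_ ->] /andP[_ ->]|/andP[_ ->] ->|-> /andP[_ ->]].
  + case: x y xy => [a|] [b|] // _ [xL yL].
    * have [gab|gab] := eqVneq (g a) (g b); last by left; rewrite /= xL yL.
      by right; apply/hasP; exists (g a); rewrite ?mem_undup ?map_f // /Q !memG gab eqxx xL yL.
    * by right; apply/hasP; exists (g a); rewrite ?mem_undup ?map_f // /Q !memG eqxx xL.
    * by right; apply/hasP; exists (g b); rewrite ?mem_undup ?map_f // /Q !memG eqxx xL yL.
- by move=> [a|] [b|] //=; rewrite eq_sym andbCA.
- by move=> x y; apply: eq_has => h; rewrite /Q andbC.
- move=> x y _; apply/negP => /andP[Pxy /hasP[h _]]; case: x y Pxy => [a|] [b|] //= /and3P[_ _ gab].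
  by rewrite /Q !memG => /andP[/andP[/eqP E _] /andP[/eqP E' _]]; rewrite E E' eqxx in gab.
Qed.

(* [f l c] is the row of the point of line [l] in column [c] of a transversal design with [k]
   columns of [m] points and [m * m] lines; column [c] is truncated to its first [u c] rows,
   and every remaining point is blown up to five points. *)
Section Wilson.
Variables (k m : nat) (f : nat -> nat -> nat) (u : nat -> nat) (e : bool).
Hypothesis k5 : 5 <= k.
Hypothesis f_lt : forall l c, f l c < m.
Hypothesis f_inj : forall c c' l l', c < c' < k -> l < m * m -> l' < m * m ->
  f l c = f l' c -> f l c' = f l' c' -> l = l'.
Hypothesis u_le : forall c, c < k -> u c <= m.
Hypothesis u_full : forall c, c < 5 -> u c = m.
Hypothesis gdd : forall j, 5 <= j <= k -> good_gdd j.
Hypothesis fill : forall c, c < k -> good_order (5 * u c + e).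

Lemma f_inj' c c' l l' : c != c' -> c < k -> c' < k -> l < m * m -> l' < m * m ->
  f l c = f l' c -> f l c' = f l' c' -> l = l'.
Proof.
have [cc'|cc'|//] := ltngtP c c' => _ ck ck' lm lm' h h'.
  by apply: (@f_inj c c'); rewrite ?cc'.
by apply: (@f_inj c' c); rewrite ?cc'.
Qed.

(** An injection of [m * m] lines into [m * m] pairs of rows is onto. *)
Lemma f_surj c c' r r' : c != c' -> c < k -> c' < k -> r < m -> r' < m ->
  exists2 l, l < m * m & f l c = r /\ f l c' = r'.
Proof.
move=> cc' ck ck' rm rm'.
pose g (l : 'I_(m * m)) := (Ordinal (f_lt l c), Ordinal (f_lt l c')).
have gI : injective g.
  move=> l l' [E E']; apply: val_inj.
  exact: (f_inj' cc' ck ck' (ltn_ord l) (ltn_ord l') E E').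
have : (Ordinal rm, Ordinal rm') \in codom g.
  by apply: (inj_card_onto gI); rewrite card_prod !card_ord.
by move=> /codomP[l [-> ->]]; exists l.
Qed.

Definition on_line (l : nat) (x : nat * nat * nat) : bool :=
  [&& x.1.1 < k, x.1.2 < u x.1.1, x.1.2 == f l x.1.1 & x.2 < 5].

(** Truncation leaves on the line the columns in [cs]. The first five are always among them, so
    [size cs] lies between 5 and [k], and the design of type 5^j with j = [size cs] is transported
    to the line. *)
Lemma good_line l : good (fun x y => [&& on_line l x, on_line l y & x.1.1 != y.1.1]).
Proof.
pose cs := [seq c <- iota 0 k | f l c < u c].
have ucs : uniq cs by rewrite filter_uniq ?iota_uniq.
have mcs c : (c \in cs) = (f l c < u c) && (c < k) by rewrite mem_filter mem_iota.
have sz : 5 <= size cs <= k.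
  apply/andP; split; last by rewrite size_filter -{2}(size_iota 0 k) count_size.
  rewrite -{1}(size_iota 0 5); apply: uniq_leq_size; first exact: iota_uniq.
  move=> c; rewrite mem_iota => /= c5.
  by rewrite mcs u_full // f_lt (leq_trans c5 k5).
pose h (p : nat * nat) : nat * nat * nat := (nth 0 cs p.1, f l (nth 0 cs p.1), p.2).
apply: (good_image (D := [pred p | (p.1 < size cs) && (p.2 < 5)]) (f := h)) (gdd sz).
- move=> [i z] [i' z']; rewrite !inE /= => /andP[ic _] /andP[ic' _] [] /eqP.
  by rewrite nth_uniq // => /eqP-> _ ->.
- by move=> [i z] [j w]; rewrite !inE /= => /and5P[-> -> -> -> _].
- move=> [i z] [j w]; rewrite !inE /on_line /= => /andP[ic ->] /andP[jc ->] _.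
  have := mem_nth 0 ic; have := mem_nth 0 jc; rewrite !mcs => /andP[-> ->] /andP[-> ->].
  by rewrite !eqxx nth_uniq // ic jc.
- move=> [[c r] z] [[c' r'] z'] _ /and3P[/and4P[/= ck ru /eqP E z5] + _].
  move=> /and4P[/= ck' ru' /eqP E' z5'].
  have cc : c \in cs by rewrite mcs -E ru.
  have cc' : c' \in cs by rewrite mcs -E' ru'.
  exists (index c cs, z), (index c' cs, z'); rewrite !inE !index_mem cc cc' z5 z5' /h /=.
  by rewrite !nth_index // -E -E'.
Qed.

(** Points in different columns determine exactly one line, whichever of the five copies they are.
    The lines together thus give a group divisible design whose groups are the columns, of [5 * u c]
    points each. *)
Lemma good_order_wilson : good_order (5 * \sum_(c < k) u c + e).
Proof.
have mz z : (z \in iota 0 5) = (z < 5) by rewrite mem_iota.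
set zs := iota 0 5 in mz.
pose L := [seq (a, z) | a <- [seq (c, r) | c <- iota 0 k, r <- iota 0 (u c)], z <- zs].
have uL : uniq L.
  apply: allpairs_uniq; rewrite ?iota_uniq //; last by move=> [a z] [b w] _ _ [-> ->].
  by apply: allpairs_uniq_dep => [|c _|[c r] [c' r'] _ _ [-> ->] //]; exact: iota_uniq.
have memL x : (x \in L) = [&& x.1.1 < k, x.1.2 < u x.1.1 & x.2 < 5].
  case: x => [[c r] z]; apply/allpairsP/and3P => /= [[[[c' r'] z'] [/= + + [-> -> ->]]]|[ck ru z5]].
    by move=> /allpairsPdep[c1 [r1 [+ + [-> ->]]]]; rewrite !mem_iota /= => -> -> ->.
  exists ((c, r), z); rewrite /= mz z5; split=> //.
  by apply/allpairsPdep; exists c, r; rewrite !mem_iota.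
have -> : 5 * \sum_(c < k) u c = size L.
  rewrite size_allpairs size_iota mulnC size_allpairs_dep sumnE big_map.
  rewrite -(big_mkord xpredT u) /index_iota subn0.
  by congr (_ * _); apply: eq_bigr => c _; rewrite size_iota.
apply: (good_fill (g := fun x => x.1.1) uL).
- pose line l x y := [&& on_line l x, on_line l y & x.1.1 != y.1.1].
  have glines : good (fun x y => has (fun l => line l x y) (iota 0 (m * m))).
  { apply: good_bigcup.
    - exact: iota_uniq.
    - by move=> l _ x y; rewrite /line andbCA eq_sym.
    - move=> x y l l' _; rewrite !mem_iota => /= lm lm'.
      move=> /and3P[/and4P[k1 _ /eqP E1 _] /and4P[k2 _ /eqP E2 _] c12].
      move=> /and3P[/and4P[_ _ /eqP E3 _] /and4P[_ _ /eqP E4 _] _].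
      by apply: (f_inj' c12) => //; rewrite -?E1 -?E2.
    - by move=> l _; apply: good_line.
  }
  apply: eq_good glines => x y xy; apply/hasP/and3P.
  + case=> l _ /and3P[/and4P[k1 u1 _ z1] /and4P[k2 u2 _ z2] c12].
    by rewrite !memL; split; first exact/and3P; first exact/and3P.
  + rewrite !memL => -[/and3P[k1 u1 z1] /and3P[k2 u2 z2] c12].
    have [l lm [E1 E2]] := f_surj c12 k1 k2 (leq_trans u1 (u_le k1)) (leq_trans u2 (u_le k2)).
    exists l; first by rewrite mem_iota.
    by apply/and3P; split=> //; apply/and4P; split=> //; apply/eqP.
- move=> [[c r] z]; rewrite memL => /= /and3P[ck ru z5].
  rewrite (_ : count _ L = 5 * u c); first exact: fill.
  have -> : 5 * u c = size [seq ((c, r), z) | r <- iota 0 (u c), z <- zs].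
    by rewrite size_allpairs !size_iota mulnC.
  rewrite -size_filter; apply/perm_size/uniq_perm.
  + exact: filter_uniq.
  + by apply: allpairs_uniq; rewrite ?iota_uniq // => [[? ?] [? ?]] _ _ [-> ->].
  + move=> [[c1 r1] z1]; rewrite mem_filter memL; apply/andP/allpairsP.
    * by case=> /= /eqP-> /and3P[_ r1u z15]; exists (r1, z1); rewrite !mem_iota.
    * by move=> [[r2 z2] [+ + [-> -> ->]]]; rewrite !mem_iota /= eqxx ck => -> ->.
Qed.
End Wilson.

(** * Verification of cyclic designs by differences *)

Lemma count_le1 (T : eqType) (p : pred T) (s : seq T) : uniq s ->
  {in s &, forall x y, p x -> p y -> x = y} -> count p s <= 1.
Proof.
move=> us h; rewrite -size_filter; case E: (filter p s) => [|x [|y s']] //.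
have u := filter_uniq p us; rewrite E in u.
have /[!mem_filter]/andP[px xs] : x \in filter p s by rewrite E mem_head.
have /[!mem_filter]/andP[py ys] : y \in filter p s by rewrite E !inE eqxx orbT.
by move: u; rewrite (h x y) //= mem_head.
Qed.

(** Two blocks with three common points share a triple. Triples suit the method of differences
    better than pairs of blocks, because a translation orbit of triples can be recognized by a
    normal form. *)
Lemma pairwise_meet_le2 (T : eqType) (B : seq (seq T)) : all uniq B ->
  (forall x y z, [/\ x != y, x != z & y != z] ->
     count [pred b | [&& x \in b, y \in b & z \in b]] B <= 1) ->
  pairwise (@meet_le2 T) B.
Proof.
elim: B => //= b B IH /andP[ub uB] h; apply/andP; split; last first.
  apply: IH => // x y z xyz; apply: leq_trans (h _ _ _ xyz).
  by rewrite leq_addl.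
apply/allP => c cB; rewrite /meet_le2 leqNgt -size_filter; apply/negP.
case E: (filter _ _) => [|x [|y [|z s]]] // _.
have u := filter_uniq [in c] ub; rewrite E /= !inE !negb_or in u.
case/and4P: u => /and3P[xy xz _] /andP[yz _] _ _.
have m w : w \in [:: x, y, z & s] -> (w \in b) && (w \in c).
  by rewrite -E mem_filter andbC.
have [/andP[xb xc] /andP[yb yc] /andP[zb zc]] :
  [/\ (x \in b) && (x \in c), (y \in b) && (y \in c) & (z \in b) && (z \in c)].
  by split; apply: m; rewrite !inE eqxx ?orbT.
have := h x y z; rewrite xy xz yz /= xb yb zb => /(_ (And3 isT isT isT)).
rewrite add1n ltnS leqn0 -leqn0 leqNgt -has_count => /hasP[]; exists c => //=.
by rewrite xc yc zc.
Qed.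

(** Binary numbers keep the checks on explicit base blocks within reach of [vm_compute]. *)
Definition pt := (N * N)%type.

Section Cyclic.
(* The points [(i, x)] with [i < r] are moved by [x |-> x + s mod n]; the [w] points
   [(r, 0), (r + 1, 0), ...] are fixed and form one group, the other groups being the
   classes of [(i, x mod t)]. *)
Variables (n r t w : N).

(** A conditional subtraction replaces the division; it agrees with addition modulo [n] for [x < n]
    and [s <= n]. The bound [s = n] is attained by [normalizer]. *)
Definition shift (s x : N) : N := let y := N.add x s in if N.ltb y n then y else N.sub y n.

Definition move (s : N) (p : pt) : pt := if N.ltb p.1 r then (p.1, shift s p.2) else p.

Definition grp (p : pt) : pt := if N.ltb p.1 r then (p.1, N.modulo p.2 t) else (r, 0%num).

Definition valid (p : pt) : bool :=
  if N.ltb p.1 r then N.ltb p.2 n else N.ltb p.1 (N.add r w) && N.eqb p.2 0%num.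

Definition gdd_rel (p q : pt) : bool := [&& valid p, valid q & grp p != grp q].

(** The translation bringing the first point to coordinate 0, or the second one when the first is
    fixed. It is [n] rather than 0 when that coordinate is already 0. *)
Definition normalizer (p q : pt) : N := N.sub n (if N.ltb p.1 r then p.2 else q.2).

Definition key (e : pt * pt) : pt * pt :=
  let a := normalizer e.1 e.2 in (move a e.1, move a e.2).

Definition triple_key (e : pt * pt * pt) : pt * pt * pt :=
  let a := normalizer e.1.1 e.1.2 in (move a e.1.1, move a e.1.2, move a e.2).

Definition Nseq (k : N) : seq N := [seq N.of_nat i | i <- iota 0 (N.to_nat k)].

Definition points : seq pt :=
  [seq (i, x) | i <- Nseq r, x <- Nseq n] ++ [seq (N.add r f, 0%num) | f <- Nseq w].

(** One representative of each translation orbit of ordered pairs across groups: a moving first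
    point sits at coordinate 0, and when the first point is fixed the second one does. *)
Definition keys : seq (pt * pt) :=
  [seq e <- [seq ((i, 0%num), q) | i <- Nseq r, q <- points] | grp e.1 != grp e.2] ++
  [seq ((N.add r f, 0%num), (j, 0%num)) | f <- Nseq w, j <- Nseq r].

(** All orderings are listed, since the normal form of a triple depends on which of its points come
    first. *)
Definition triples (b : seq pt) : seq (pt * pt * pt) :=
  [seq e <- [seq (pq, u) | pq <- [seq (p, q) | p <- b, q <- b], u <- b]
     | [&& e.1.1 != e.1.2, e.1.1 != e.2 & e.1.2 != e.2]].

(* [keys] is listed in increasing order of [code], so that sorting by [code] is enough to
   compare the keys of a family of base blocks with twice [keys]. *)
Definition code (k : pt * pt) : N :=
  N.add (N.mul (N.add (N.mul k.1.1 (N.add r w)) k.2.1) n) k.2.2.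

Definition triple_code (k : pt * pt * pt) : N :=
  N.add (N.mul (N.add (N.mul (code k.1) (N.add r w)) k.2.1) n) k.2.2.

Definition check_blocks (B : seq (seq pt)) : bool :=
  all (fun b => (size b == 5) && all (fun e => gdd_rel e.1 e.2) (pairs_of b)) B.

(** Each key travels with its code, so equality of the lists yields a permutation of the keys
    themselves. For triples distinctness is the only issue, and distinct codes already mean distinct
    keys. *)
Definition check_pairs (B : seq (seq pt)) : bool :=
  sort (fun u v => N.leb u.1 v.1) [seq (code k, k) | k <- map key (flatten (map (@pairs_of pt) B))]
  == [seq (code k, k) | k <- flatten [seq [:: k; k] | k <- keys]].

Definition check_triples (B : seq (seq pt)) : bool :=
  sorted N.ltb (sort N.leb (map triple_code (map triple_key (flatten (map triples B))))).

Definition mates (B : seq (seq pt)) (sg : seq (nat * N)) : seq (seq pt) :=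
  [seq map (move e.2) (nth [::] B e.1) | e <- sg].

Definition check_mates (B : seq (seq pt)) (sg : seq (nat * N)) : bool :=
  [&& sort leq (map fst sg) == iota 0 (size B), all (fun e => N.ltb e.2 n) sg
    & all2 (@swap_mates pt) B (mates B sg)].

Definition check (B : seq (seq pt)) (sg : seq (nat * N)) : bool :=
  [&& check_blocks B, check_pairs B, check_triples B & check_mates B sg].

Lemma mem_Nseq k s : (s \in Nseq k) = N.ltb s k.
Proof.
apply/mapP/idP => [[i]|/N.ltb_spec0 sk].
  by rewrite mem_iota => /= ik ->; apply/N.ltb_spec0; lia.
by exists (N.to_nat s); rewrite ?mem_iota /=; lia.
Qed.

Lemma uniq_Nseq k : uniq (Nseq k).
Proof. by rewrite map_inj_uniq ?iota_uniq // => a b; lia. Qed.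

Lemma mem_points p : (p \in points) = valid p.
Proof.
rewrite mem_cat /valid; apply/orP/idP.
- case=> [/allpairsP[[i x] [/= + + ->]]|/mapP[f + ->]] /=; rewrite !mem_Nseq; first by move=> ->.
  move=> /N.ltb_spec0 fw.
  case: N.ltb_spec => ?; first by lia.
  by rewrite andbT; apply/N.ltb_spec0; lia.
- case: p => i x /=.
  case: N.ltb_spec => [/N.ltb_spec0 ir xn|le /andP[/N.ltb_spec0 lt /N.eqb_spec ->]].
    by left; apply/allpairsP; exists (i, x); rewrite !mem_Nseq.
  right; apply/mapP; exists (N.sub i r); first by rewrite mem_Nseq; apply/N.ltb_spec0; lia.
  by congr (_, _); lia.
Qed.

Lemma uniq_points : uniq points.
Proof.
rewrite cat_uniq allpairs_uniq ?uniq_Nseq //=; last by move=> [? ?] [? ?] _ _ [-> ->].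
rewrite map_inj_uniq ?uniq_Nseq ?andbT; last by move=> f f' []; lia.
rewrite -all_predC; apply/allP => _ /mapP[f _ ->] /=.
apply/allpairsP => -[[i x] [/= + _ [E _]]].
by rewrite mem_Nseq => /N.ltb_spec0; lia.
Qed.

Lemma uniq_keys : uniq keys.
Proof.
rewrite cat_uniq filter_uniq; last first.
  by apply: allpairs_uniq; rewrite ?uniq_Nseq ?uniq_points // => -[? ?] [? ?] _ _ [-> ->].
apply/andP; split=> //; apply/andP; split.
  rewrite -all_predC; apply/allP => _ /allpairsP[[f j] [_ _ ->]] /=.
  rewrite mem_filter; apply/negP => /andP[_ /allpairsP[[i q] [/= + _ [E _]]]].
  by rewrite mem_Nseq => /N.ltb_spec0; lia.
by apply: allpairs_uniq; rewrite ?uniq_Nseq // => -[f j] [f' j'] _ _ /= [E ->]; congr (_, _); lia.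
Qed.

(** * Translations and their free action on pairs across groups *)

Hypothesis n_gt0 : (0 < n)%num.
Hypothesis t_gt0 : (0 < t)%num.
Variable cls : N.
Hypothesis nE : n = (cls * t)%num.

Definition shifts : seq N := Nseq n.

Definition mem_shifts := mem_Nseq n.
Definition uniq_shifts := uniq_Nseq n.

Lemma shiftE s x : (x < n)%num -> (s <= n)%num -> shift s x = N.modulo (x + s) n.
Proof.
move=> xn sn; rewrite /shift; cbv zeta; case: N.ltb_spec => xs; first by rewrite N.mod_small.
have E : (x + s = (x + s - n) + 1 * n)%num by lia.
by rewrite [in RHS]E N.Div0.mod_add N.mod_small //; lia.
Qed.

Lemma shift_lt s x : (x < n)%num -> (s <= n)%num -> (shift s x < n)%num.
Proof. by move=> xn sn; rewrite shiftE //; apply: N.mod_lt; lia. Qed.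

Lemma shiftA s s' x : (x < n)%num -> (s <= n)%num -> (s' <= n)%num ->
  shift s (shift s' x) = shift (N.modulo (s + s') n) x.
Proof.
move=> xn sn s'n; have lt := N.mod_lt (s + s') n.
rewrite [shift s' x]shiftE // !shiftE ?N.Div0.add_mod_idemp_l ?N.Div0.add_mod_idemp_r; try lia.
- by congr N.modulo; lia.
- by apply: N.mod_lt; lia.
Qed.

Lemma shift_inj s s' x : (x < n)%num -> (s < n)%num -> (s' < n)%num ->
  shift s x = shift s' x -> s = s'.
Proof.
by move=> xn sn s'n; rewrite /shift; cbv zeta; case: N.ltb_spec => ?; case: N.ltb_spec => ?; lia.
Qed.

Lemma shift_modt s x : (x < n)%num -> (s <= n)%num ->
  N.modulo (shift s x) t = N.modulo (x + s)%num t.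
Proof.
move=> xn sn; rewrite /shift; cbv zeta; case: N.ltb_spec => // le.
have E : (x + s = (x + s - n) + cls * t)%num by rewrite -nE; lia.
by rewrite [in RHS]E N.Div0.mod_add.
Qed.

Lemma shift_modt_eq s x y : (x < n)%num -> (y < n)%num -> (s <= n)%num ->
  (N.modulo (shift s x) t == N.modulo (shift s y) t) = (N.modulo x t == N.modulo y t).
Proof.
move=> xn yn sn; rewrite !shift_modt //; apply/eqP/eqP => E.
  (* Adding the complement of [s] modulo [n] undoes the translation; this is visible modulo [t]
     because [n = cls * t]. *)
  have back z : N.modulo z t = N.modulo (N.modulo (z + s) t + (cls * t - N.modulo s (cls * t))) t.
    have lt := N.mod_lt s (cls * t).
    rewrite N.Div0.add_mod_idemp_l {1}[in RHS](N.div_mod s (cls * t)); last by lia.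
    rewrite (_ : _ + _ = z + (s / (cls * t) * cls + cls) * t)%num ?N.Div0.mod_add //.
    by rewrite N.mul_add_distr_r; lia.
  by rewrite [LHS]back E -back.
by rewrite -N.Div0.add_mod_idemp_l E N.Div0.add_mod_idemp_l.
Qed.

Lemma moveA s s' p : valid p -> (s <= n)%num -> (s' <= n)%num ->
  move s (move s' p) = move (N.modulo (s + s') n) p.
Proof.
rewrite /valid /move => + sn s'n; case E: (N.ltb p.1 r); rewrite /= E // => /N.ltb_spec0 pn.
by rewrite shiftA.
Qed.

Lemma move0 p : valid p -> move 0%num p = p.
Proof.
rewrite /valid /move; case E: (N.ltb p.1 r) => // /N.ltb_spec0 pn.
rewrite /shift N.add_0_r; cbv zeta; case: N.ltb_spec => le; last by lia.
by case: (p).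
Qed.

Lemma valid_move s p : valid p -> (s <= n)%num -> valid (move s p).
Proof.
rewrite /valid /move => + sn; case E: (N.ltb p.1 r); rewrite /= E // => /N.ltb_spec0 pn.
by apply/N.ltb_spec0/shift_lt.
Qed.

Lemma grp_move s p q : valid p -> valid q -> (s <= n)%num ->
  (grp (move s p) == grp (move s q)) = (grp p == grp q).
Proof.
rewrite /valid /move /grp => + + sn.
case E: (N.ltb p.1 r); case F: (N.ltb q.1 r); rewrite /= ?E ?F //.
  move=> /N.ltb_spec0 pn /N.ltb_spec0 qn.
  by rewrite !xpair_eqE shift_modt_eq.
- by move=> _ _; rewrite !xpair_eqE; case: eqP E => // -> /N.ltb_spec0; lia.
- by move=> _ _; rewrite !xpair_eqE; case: eqP F => // <- /N.ltb_spec0; lia.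
Qed.

Lemma rel_move s p q : gdd_rel p q -> (s <= n)%num -> gdd_rel (move s p) (move s q).
Proof.
by move=> /and3P[vp vq gpq] sn; rewrite /gdd_rel !valid_move // grp_move.
Qed.

Lemma rel_sym p q : gdd_rel p q = gdd_rel q p.
Proof. by rewrite /gdd_rel andbCA eq_sym. Qed.

(** All fixed points form a single group, so a pair across groups has a moving point; this is what
    makes translations act freely on such pairs. *)
Lemma rel_moves p q : gdd_rel p q -> N.ltb p.1 r || N.ltb q.1 r.
Proof. by move=> /and3P[_ _]; rewrite /grp; do 2 case: N.ltb => //; rewrite eqxx. Qed.

Lemma move_inj s s' p : valid p -> N.ltb p.1 r -> (s < n)%num -> (s' < n)%num ->
  move s p = move s' p -> s = s'.
Proof. by rewrite /valid /move => + E sn s'n; rewrite E => /N.ltb_spec0 pn [] /shift_inj->. Qed.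

Lemma move_pair_inj s s' p q : gdd_rel p q -> (s < n)%num -> (s' < n)%num ->
  move s p = move s' p -> move s q = move s' q -> s = s'.
Proof.
move=> R sn s'n; have /and3P[vp vq _] := R.
by case/orP: (rel_moves R) => mp Ep Eq; [apply: move_inj Ep|apply: move_inj Eq].
Qed.

Lemma normalizer_le p q : (normalizer p q <= n)%num.
Proof. by rewrite /normalizer; lia. Qed.

(** Translating a pair by [s] changes its normalizer by [- s]. As numbers the two sides agree only
    modulo [n], hence the comparison through the action on points. *)
Lemma move_normalizer s p q : gdd_rel p q -> (s <= n)%num ->
  let a := normalizer p q in let b := normalizer (move s p) (move s q) in
  forall u, valid u -> move b (move s u) = move a u.
Proof.
move=> R sn a b u vu; have /and3P[vp vq _] := R.
rewrite moveA //; last exact: normalizer_le.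
have step x : (x < n)%num -> N.modulo (n - shift s x + s) n = N.modulo (n - x) n.
  move=> xn; rewrite /shift; cbv zeta; case: N.ltb_spec => le.
    by congr N.modulo; lia.
  by rewrite (_ : n - (x + s - n) + s = n - x + 1 * n)%num ?N.Div0.mod_add //; lia.
have -> : N.modulo (b + s) n = N.modulo a n.
  move: (rel_moves R) vp vq; rewrite /b /a /normalizer /move /valid.
  case E: (N.ltb p.1 r); first by rewrite /= E => _ /N.ltb_spec0 pn _; apply: step.
  case F: (N.ltb q.1 r) => //; rewrite /= ?E ?F => _ _ /N.ltb_spec0 qn; exact: step.
rewrite -[in RHS](move0 vu) moveA ?N.add_0_r //; last by lia.
exact: normalizer_le.
Qed.

Lemma key_move s p q : gdd_rel p q -> (s <= n)%num -> key (move s p, move s q) = key (p, q).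
Proof.
move=> R sn; have /and3P[vp vq _] := R.
by rewrite /key /= !(move_normalizer R sn).
Qed.

Lemma triple_key_move s p q u : gdd_rel p q -> valid u -> (s <= n)%num ->
  triple_key (move s p, move s q, move s u) = triple_key (p, q, u).
Proof.
move=> R vu sn; have /and3P[vp vq _] := R.
by rewrite /triple_key /= !(move_normalizer R sn).
Qed.

Lemma move_unnormalize a x : valid x -> (a <= n)%num -> move (n - a) (move a x) = x.
Proof.
move=> vx an; rewrite moveA //; last by lia.
by rewrite (_ : n - a + a = n)%num ?N.Div0.mod_same ?move0 //; lia.
Qed.

(** The heart of the method of differences: two pairs in the same orbit are related by exactly one
    translation, two pairs in different orbits by none. *)
Lemma count_shifts p q x y : gdd_rel p q -> gdd_rel x y ->
  count (fun s => (move s p, move s q) == (x, y)) shifts = (key (p, q) == key (x, y)).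
Proof.
move=> R Rxy; have /and3P[vp vq _] := R; have /and3P[vx vy _] := Rxy.
have sl s : s \in shifts -> (s < n)%num by rewrite mem_shifts => /N.ltb_spec0.
case: eqP => [[E1 E2]|NE]; last first.
  apply/eqP; rewrite -leqn0 leqNgt -has_count; apply/hasP => -[s sS /eqP[Ex Ey]].
  by apply: NE; rewrite -Ex -Ey key_move //; have := sl _ sS; lia.
set a := normalizer p q in E1 E2; set b := normalizer x y in E1 E2.
have an : (a <= n)%num by apply: normalizer_le.
have bn : (b <= n)%num by apply: normalizer_le.
(* Normalize (p, q) by [a], then undo the normalization of (x, y) by [n - b]. *)
pose s0 := N.modulo (n - b + a) n.
have s0n : (s0 < n)%num by apply: N.mod_lt; lia.
have M1 : move s0 p = x by rewrite -moveA //; [rewrite E1 move_unnormalize | lia].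
have M2 : move s0 q = y by rewrite -moveA //; [rewrite E2 move_unnormalize | lia].
have s0S : s0 \in shifts by rewrite mem_shifts; apply/N.ltb_spec0.
have := count_uniq_mem s0 uniq_shifts; rewrite s0S => <-.
apply: eq_in_count => s sS; apply/eqP/eqP => [[Ex Ey]|->]; last by rewrite M1 M2.
by apply: (move_pair_inj R) => //; rewrite ?M1 ?M2 //; apply: sl.
Qed.

Lemma key_in_keys x y : gdd_rel x y -> key (x, y) \in keys.
Proof.
move=> R; have /and3P[vx vy gxy] := R.
have an : (normalizer x y <= n)%num by apply: normalizer_le.
have zero i z : N.ltb i r -> N.ltb z n -> move (N.sub n z) (i, z) = (i, 0%num).
  move=> ir /N.ltb_spec0 zn; rewrite /move /= ir /shift; cbv zeta.
  by case: N.ltb_spec => ?; congr (_, _); lia.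
rewrite mem_cat mem_filter /key /=.
case E: (N.ltb x.1 r).
- have Ex : move (normalizer x y) x = (x.1, 0%num).
    rewrite /normalizer E; case: x E vx {R gxy an} => i z /= E; rewrite /valid /= E; exact: zero.
  apply/orP; left; rewrite grp_move // gxy /= Ex.
  apply/allpairsP; exists (x.1, move (normalizer x y) y); split=> //.
    by rewrite mem_Nseq.
  by rewrite mem_points valid_move.
- have F : N.ltb y.1 r by move: (rel_moves R); rewrite E.
  apply/orP; right; apply/allpairsP; exists (N.sub x.1 r, y.1) => /=.
  rewrite !mem_Nseq F; move: vx; rewrite /valid E => /andP[/N.ltb_spec0 lt /N.eqb_spec x0].
  move/N.ltb_spec0: (E) => le; split=> //; first by apply/N.ltb_spec0; lia.
  congr (_, _); last first.
    by rewrite /normalizer E; case: y F vy {R gxy an} => i z /= F; rewrite /valid /= F; exact: zero.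
  by rewrite /move E; case: x x0 le {R gxy an vy E lt} => i z /= -> le; congr (_, _); lia.
Qed.

Definition develop (B : seq (seq pt)) : seq (seq pt) := [seq map (move s) b | b <- B, s <- shifts].

Lemma countE (T : Type) (p : pred T) s : count p s = \sum_(x <- s) p x.
Proof. by rewrite -sum1_count big_mkcond; apply: eq_bigr => x _; case: (p x). Qed.

Lemma shiftsP s : s \in shifts -> (s <= n)%num.
Proof. by rewrite mem_shifts => /N.ltb_spec0; lia. Qed.

(** * From base blocks to developed blocks *)

Section Check.
Variables (B : seq (seq pt)) (sg : seq (nat * N)).
Hypothesis cB : check_blocks B.

Lemma block_rel b : b \in B -> {in b &, forall p q, p != q -> gdd_rel p q}.
Proof.
move=> bB p q pb qb pq; have /andP[_ /allP h] := allP cB _ bB.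
by case/orP: (mem_pairs_of pb qb pq) => /h //=; rewrite rel_sym.
Qed.

Lemma block_valid b p : b \in B -> p \in b -> valid p.
Proof.
move=> bB pb; have /andP[/eqP sb /allP h] := allP cB _ bB.
case: b sb pb h {bB} => [|x [|y b]] // _; rewrite !inE => /or3P[/eqP->|/eqP->|pb] h.
- by have /and3P[] := h (x, y) (mem_head _ _).
- by have /and3P[] := h (x, y) (mem_head _ _).
- have m : (x, p) \in [seq (x, z) | z <- y :: b] ++ pairs_of (y :: b).
    by rewrite mem_cat (map_f (fun z => (x, z))) // inE pb orbT.
  by case/and3P: (h _ m).
Qed.

Lemma block_uniq b : b \in B -> uniq b.
Proof.
move=> bB; have /andP[_] := allP cB _ bB; elim: (b) => //= x s IH.
rewrite all_cat => /andP[/allP h /IH ->]; rewrite andbT; apply/negP => xs.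
have /h/and3P[_ _] : (x, x) \in [seq (x, y) | y <- s] by rewrite map_f.
by rewrite eqxx.
Qed.

Lemma move_block_inj b s : b \in B -> (s <= n)%num -> {in b &, injective (move s)}.
Proof.
move=> bB sn p q pb qb E; apply/eqP; apply: contraT => pq.
have /and3P[_ _] := rel_move (block_rel bB pb qb pq) sn.
by rewrite E eqxx.
Qed.

(** Each pair of a base block in the orbit of (x, y) contributes one translate, so the coverage is
    the multiplicity of [key (x, y)] among the base keys, which [check_pairs] makes 2. *)
Lemma covers_develop x y : x != y -> check_pairs B ->
  covers (x, y) (develop B) = (gdd_rel x y).*2.
Proof.
move=> xy /eqP cP.
have -> : covers (x, y) (develop B) = \sum_(b <- B) \sum_(e <- pairs_of b)
    count (fun s => (move s e.1, move s e.2) == (x, y)) shifts.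
  rewrite coversE /develop big_allpairs_dep; apply: eq_bigr => b _.
  rewrite (eq_bigr (fun s => \sum_(e <- pairs_of b) ((move s e.1, move s e.2) == (x, y)))).
    by rewrite exchange_big; apply: eq_bigr => e _; rewrite countE.
  by move=> s _; rewrite map_pairs_of count_map countE.
have relB b e : b \in B -> e \in pairs_of b -> gdd_rel e.1 e.2.
  by move=> bB; have /andP[_ /allP h] := allP cB _ bB; apply: h.
case R: (gdd_rel x y); last first.
  rewrite big_seq big1 // => b bB; rewrite big_seq big1 // => e eb.
  apply/eqP; rewrite -leqn0 leqNgt -has_count; apply/hasP => -[s sS /eqP[Ex Ey]].
  by have := rel_move (relB _ _ bB eb) (shiftsP sS); rewrite Ex Ey R.
rewrite (eq_big_seq (fun b => count_mem (key (x, y)) (map key (pairs_of b)))); last first.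
  move=> b bB; rewrite count_map countE; apply: eq_big_seq => -[p q] eb.
  by rewrite count_shifts //; apply: (relB _ _ bB eb).
have pE : perm_eq (map key (flatten (map (@pairs_of pt) B))) (flatten [seq [:: k; k] | k <- keys]).
  apply: (@perm_map_inj _ _ (fun k => (code k, k))); first by move=> k k' [].
  by rewrite -cP perm_sym perm_sort.
transitivity (count_mem (key (x, y)) (map key (flatten (map (@pairs_of pt) B)))).
  rewrite -(big_map (@pairs_of pt) xpredT (fun l => count_mem (key (x, y)) (map key l))).
  elim: (map _ B) => [|l ls IH]; first by rewrite big_nil.
  by rewrite big_cons IH /= map_cat count_cat.
(* The target 2 is rewritten as twice the multiplicity of the key in [keys], a form that passes
   through an induction on [keys]. *)
rewrite (permP pE) -[1.*2]/(true.*2) -(key_in_keys R) -(count_uniq_mem _ uniq_keys).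
by elim: keys => //= k s ->; rewrite doubleD -[(k == _).*2]addnn addnA.
Qed.

Lemma triplesP b x y z : (x, y, z) \in triples b ->
  [/\ x \in b, y \in b, z \in b & x != y].
Proof.
rewrite mem_filter => /andP[/= /and3P[xy _ _] /allpairsP[[e u] [/= eb ub [E ->]]]].
by move: eb xy; rewrite -E => /allpairsP[[p q] [/= pb qb [-> ->]]].
Qed.

(** The developed blocks through a triple are at most as many as the base triples with its key, and
    [check_triples] leaves at most one of these. *)
Lemma super_develop : check_triples B -> pairwise (@meet_le2 pt) (develop B).
Proof.
move=> cT.
have uT : uniq (map triple_key (flatten (map triples B))).
  apply: (@map_uniq _ _ triple_code); rewrite -(sort_uniq N.leb).
  apply: sorted_uniq cT.
    by move=> a b c /N.ltb_spec0 ? /N.ltb_spec0 ?; apply/N.ltb_spec0; lia.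
  by move=> a; apply: N.ltb_irrefl.
apply: pairwise_meet_le2.
  apply/allP => _ /allpairsP[[b s] [/= bB sS ->]].
  by rewrite map_inj_in_uniq ?block_uniq //; apply: move_block_inj (shiftsP sS).
move=> x y z [xy xz yz].
(* A translate containing the three points is charged to the ordered triple of their preimages in
   the base block. *)
have H3 s b : b \in B -> s \in shifts ->
    [&& x \in map (move s) b, y \in map (move s) b & z \in map (move s) b] <=
    count (fun e => (move s e.1.1, move s e.1.2, move s e.2) == (x, y, z)) (triples b).
  move=> bB sS; case: and3P => // -[/mapP[p pb xp] /mapP[q qb yq] /mapP[u ub zu]].
  rewrite -[nat_of_bool true]/1 -has_count; apply/hasP.
  exists (p, q, u); last by rewrite /= xp yq zu.
  rewrite mem_filter /=; apply/andP; split.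
    by apply/and3P; split; [move: xy|move: xz|move: yz]; rewrite ?xp ?yq ?zu;
      apply: contraNneq => ->.
  by apply/allpairsP; exists ((p, q), u); split=> //; apply/allpairsP; exists (p, q).
(* Freeness on the first two points already limits each base triple to one translation. *)
have H4 b e : b \in B -> e \in triples b ->
    count (fun s => (move s e.1.1, move s e.1.2, move s e.2) == (x, y, z)) shifts <=
    (triple_key e == triple_key (x, y, z)).
  case: e => [[p q] u] bB /triplesP[pb qb ub pq] /=.
  have R := block_rel bB pb qb pq; have vu := block_valid bB ub.
  pose hit s := (move s p, move s q, move s u) == (x, y, z).
  have [/hasP[s sS /eqP[<- <- <-]]|] := boolP (has hit shifts).
    rewrite (triple_key_move R vu (shiftsP sS)) eqxx; apply: count_le1; first exact: uniq_shifts.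
    move=> s1 s2; rewrite !mem_shifts => /N.ltb_spec0 l1 /N.ltb_spec0 l2.
    move=> /eqP[E1 E2 _] /eqP[E3 E4 _].
    by apply: (move_pair_inj R) => //; rewrite ?E1 ?E3 ?E2 ?E4.
  by rewrite has_count -leqNgt leqn0 => /eqP->.
rewrite countE /develop big_allpairs_dep /=.
apply: leq_trans (_ : \sum_(b <- B) \sum_(e <- triples b)
                         (triple_key e == triple_key (x, y, z)) <= 1).
  rewrite big_seq [X in _ <= X]big_seq; apply: leq_sum => b bB.
  apply: leq_trans (_ : \sum_(s <- shifts) \sum_(e <- triples b)
    ((move s e.1.1, move s e.1.2, move s e.2) == (x, y, z)) <= _).
    rewrite big_seq [X in _ <= X]big_seq; apply: leq_sum => s sS.
    by rewrite -countE; apply: H3.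
  rewrite exchange_big big_seq [X in _ <= X]big_seq; apply: leq_sum => e eb.
  by rewrite -countE; apply: H4 bB eb.
have -> : \sum_(b <- B) \sum_(e <- triples b) (triple_key e == triple_key (x, y, z)) =
    count_mem (triple_key (x, y, z)) (map triple_key (flatten (map triples B))).
  elim: (B) => [|b B' IH]; first by rewrite big_nil.
  by rewrite big_cons IH /= map_cat count_cat; congr (_ + _); rewrite count_map countE.
by rewrite count_uniq_mem //; case: (_ \in _).
Qed.

(** Replacing a base block by a translate only rotates its orbit, and the first components of [sg]
    run once through all base blocks. *)
Lemma perm_develop : check_mates B sg -> perm_eq (develop (mates B sg)) (develop B).
Proof.
case/and3P => /eqP sE /allP dl _; apply/permP => a.
have orb b d : b \in B -> N.ltb d n ->
    count a [seq map (move s) (map (move d) b) | s <- shifts] =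
    count a [seq map (move s) b | s <- shifts].
  move=> bB /N.ltb_spec0 dn.
  have pS : perm_eq [seq N.modulo (s + d) n | s <- shifts] shifts.
    apply: uniq_perm; [|exact: uniq_shifts|].
      rewrite map_inj_in_uniq ?uniq_shifts // => s s'; rewrite !mem_shifts.
      move=> /N.ltb_spec0 sn /N.ltb_spec0 s'n E.
      have sh u : (u < n)%num -> shift d u = N.modulo (u + d) n.
        by move=> un; rewrite shiftE //; lia.
      by move: E; rewrite -!sh // /shift; cbv zeta; do 2 case: N.ltb_spec => ?; lia.
    move=> u; rewrite mem_shifts; apply/mapP/N.ltb_spec0 => [[s _ ->]|un].
      by apply: N.mod_lt; lia.
    (* This is [u - d] modulo [n], arranged so that no subtraction is truncated. *)
    exists (N.modulo (u + (n - d)) n).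
      by rewrite mem_shifts; apply/N.ltb_spec0/N.mod_lt; lia.
    rewrite N.Div0.add_mod_idemp_l (_ : u + (n - d) + d = u + 1 * n)%num; last by lia.
    by rewrite N.Div0.mod_add N.mod_small.
  transitivity (count a (map (fun s => map (move s) b) [seq N.modulo (s + d) n | s <- shifts])).
    rewrite -map_comp; congr (count a _).
    apply/eq_in_map => s sS /=; rewrite -map_comp; apply/eq_in_map => p pb /=.
    rewrite moveA //; [exact: block_valid pb | exact: shiftsP | lia].
  exact: (permP (perm_map _ pS)).
have cnt C : count a (develop C) = \sum_(c <- C) count a [seq map (move s) c | s <- shifts].
  by elim: C => [|c C IH]; rewrite ?big_nil // big_cons -IH /develop /= count_cat.
rewrite !cnt /mates big_map.
transitivity (\sum_(e <- sg) count a [seq map (move s) (nth [::] B e.1) | s <- shifts]).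
  rewrite big_seq [RHS]big_seq; apply: eq_bigr => e eS; apply: orb; last exact: dl.
  apply: mem_nth; have : e.1 \in iota 0 (size B) by rewrite -sE mem_sort map_f.
  by rewrite mem_iota.
rewrite -(big_map fst xpredT (fun j => count a [seq map (move s) (nth [::] B j) | s <- shifts])).
rewrite (perm_big (iota 0 (size B))); last by rewrite -sE perm_sym perm_sort.
by rewrite [RHS](big_nth [::]) /index_iota subn0.
Qed.

Lemma all2_develop C : all2 (@swap_mates pt) B C -> all2 (@swap_mates pt) (develop B) (develop C).
Proof.
elim: (B) C => [|b B' IH] [|c C] //= /andP[bc BC]; rewrite /develop /=.
apply: swap_mates_cat; last exact: IH.
by elim: shifts => //= s ss ->; rewrite swap_mates_map.
Qed.
End Check.

Lemma good_check B sg : check B sg -> good gdd_rel.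
Proof.
case/and4P => cB cP cT cM; exists (develop B), (develop (mates B sg)); split.
- apply/allP => _ /allpairsP[[b s] [/= bB sS ->]]; have /andP[sb _] := allP cB _ bB.
  rewrite size_map sb map_inj_in_uniq ?(block_uniq cB) //.
  exact: (move_block_inj cB bB (shiftsP sS)).
- by move=> x y xy; apply: covers_develop.
- exact: super_develop.
- exact: perm_develop.
- by apply: all2_develop; case/and3P: cM.
Qed.
End Cyclic.

(** * From checked base blocks to orders and group divisible designs *)

Lemma good_order_le1 v : v <= 1 -> good_order v.
Proof.
move=> v1; apply: eq_good (good_pred0 nat) => x y xy; apply/esym/negP => /andP[xv yv].
by case/eqP: xy; lia.
Qed.

Lemma size_Nseq k : size (Nseq k) = N.to_nat k.
Proof. by rewrite size_map size_iota. Qed.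

Section FromCheck.
Variables (n r t w cls : N) (B : seq (seq pt)) (sg : seq (nat * N)).
Hypothesis t_gt0 : (0 < t)%num.
Hypothesis cls_gt0 : (0 < cls)%num.
Hypothesis nE : n = (cls * t)%num.
Hypothesis chk : check n r t w B sg.

Lemma count_moving_class i y : N.ltb i r -> N.ltb y n ->
  count [pred x | grp r t x == grp r t (i, y)] (points n r w) = N.to_nat cls.
Proof.
move=> ir /N.ltb_spec0 yn.
pose u := N.modulo y t.
have ut : (u < t)%num by apply: N.mod_lt; lia.
rewrite -(size_Nseq cls) -(size_map (fun z => (i, u + z * t)%num)) -size_filter.
apply/perm_size/uniq_perm.
- by rewrite filter_uniq // uniq_points.
- by rewrite map_inj_uniq ?uniq_Nseq // => z z' []; nia.
- move=> [j x]; rewrite mem_filter mem_points /valid /grp /= ir; apply/andP/mapP.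
  + case: N.ltb_spec => jr; last by case=> /eqP[E]; move/N.ltb_spec0: ir; lia.
  case=> /eqP[-> E] /N.ltb_spec0 xn; exists (N.div x t).
    rewrite mem_Nseq; apply/N.ltb_spec0; apply: N.Div0.div_lt_upper_bound; lia.
  by congr (_, _); rewrite /u -E {1}(N.div_mod x t); lia.
  + case=> z; rewrite mem_Nseq => /N.ltb_spec0 zc [-> ->]; rewrite ir; split.
    by rewrite N.Div0.mod_add N.mod_small.
  by apply/N.ltb_spec0; nia.
Qed.

Lemma count_fixed_class f :
  count [pred x | grp r t x == grp r t (N.add r f, 0%num)] (points n r w) = N.to_nat w.
Proof.
rewrite -(size_Nseq w) -(size_map (fun z => (N.add r z, 0%num))) -size_filter.
have nr g : N.ltb (N.add r g) r = false by apply/N.ltb_spec0; lia.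
apply/perm_size/uniq_perm.
- by rewrite filter_uniq // uniq_points.
- by rewrite map_inj_uniq ?uniq_Nseq // => z z' []; lia.
- move=> [j x]; rewrite mem_filter mem_points /valid /grp /= nr; apply/andP/mapP.
  + case: N.ltb_spec => jr; first by case=> /eqP[E]; lia.
  case=> _ /andP[/N.ltb_spec0 jw /N.eqb_spec ->]; exists (N.sub j r).
    by rewrite mem_Nseq; apply/N.ltb_spec0; lia.
  by congr (_, _); lia.
  + case=> z; rewrite mem_Nseq => /N.ltb_spec0 zc [-> ->]; rewrite nr eqxx; split=> //.
    by apply/andP; split=> //; apply/N.ltb_spec0; lia.
Qed.

Lemma good_order_check (e : bool) :
  good_order (N.to_nat cls + e) -> good_order (N.to_nat w + e) ->
  good_order (N.to_nat (r * n + w) + e).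
Proof.
move=> gc gw.
have n0 : (0 < n)%num by nia.
have -> : N.to_nat (r * n + w) = size (points n r w).
  by rewrite size_cat size_allpairs !size_map !size_iota Nnat.N2Nat.inj_add Nnat.N2Nat.inj_mul.
apply: (good_fill (g := grp r t)); first exact: uniq_points.
- apply: eq_good (good_check n0 t_gt0 nE chk) => x y _.
  by rewrite !mem_points.
- move=> [i y]; rewrite mem_points /valid /=; case: N.ltb_spec => ir.
    by move=> yn; rewrite count_moving_class //; apply/N.ltb_spec0.
  move=> /andP[_ /N.eqb_spec ->].
  by rewrite (_ : i = N.add r (N.sub i r)) ?count_fixed_class //; lia.
Qed.
End FromCheck.

(** The group Z/5 acts on [k] copies of itself: [t = 1] makes each copy one group, and there are no
    fixed points. *)
Lemma good_gdd_check (k : N) B sg : check 5 k 1 0 B sg -> good_gdd (N.to_nat k).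
Proof.
move=> chk.
have := good_check (n := 5) (r := k) (t := 1) (w := 0) (cls := 5) _ _ _ chk.
move=> /(_ erefl erefl erefl).
apply: (good_image (D := [pred p : pt | N.ltb p.1 k && N.ltb p.2 5])
                   (f := fun p : pt => (N.to_nat p.1, N.to_nat p.2))).
- by move=> [i x] [j y] _ _ [E F]; congr (_, _); lia.
- have v p : valid 5 k 0 p -> p \in [pred p : pt | N.ltb p.1 k && N.ltb p.2 5].
    by rewrite /valid inE N.add_0_r; case: (N.ltb p.1 k).
  by move=> x y /and3P[/v -> /v ->].
- move=> [i x] [j y]; rewrite !inE /= => /andP[ik x5] /andP[jk y5] _.
  rewrite /gdd_rel /valid /grp /= ik jk x5 y5 /= !N.mod_1_r xpair_eqE andbT.
  move/N.ltb_spec0: ik; move/N.ltb_spec0: jk; move/N.ltb_spec0: x5; move/N.ltb_spec0: y5 => *.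
  have -> : (N.to_nat i == N.to_nat j) = (i == j) by apply/eqP/eqP; lia.
  by apply/and5P/idP => [[] //|ij]; split=> //; lia.
- move=> [i x] [j y] _ /= /and5P[ik x5 jk y5 _].
  exists (N.of_nat i, N.of_nat x), (N.of_nat j, N.of_nat y).
  rewrite !inE /= !Nnat.Nat2N.id; split=> //; apply/andP; split; apply/N.ltb_spec0; lia.
Qed.

(** * Base blocks *)

(* A row [(a, b, c, d, e, j, s)] is the base block [(a, b, c, d, e)], whose mate is the base
   block number [j] translated by [s]; the number [i * n + x] stands for the point [(i, x)],
   and [r * n + f] for the fixed point [(r + f, 0)].  The rows [rows_n_e] are for a design on
   [5 n + e] points, [rows_n] for a group divisible design on [5 n] points, and [rows_gk] for
   one of type 5^k. *)
Definition base_row := (N * N * N * N * N * N * N)%type.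

Definition decode (n r p : N) : pt :=
  if N.ltb p (N.mul r n) then (N.div p n, N.modulo p n)
  else (N.add r (N.sub p (N.mul r n)), 0%num).

Definition row_block (n r : N) (d : base_row) : seq pt :=
  let: (a, b, c, d, e, _, _) := d in map (decode n r) [:: a; b; c; d; e].

Definition row_mate (d : base_row) : nat * N := (N.to_nat d.1.2, d.2).

Definition check_rows (n r t w : N) (d : seq base_row) : bool :=
  check n r t w (map (row_block n r) d) (map row_mate d).

(** * Base blocks of designs on 5n and 5n + 1 points *)

Definition rows_3_0 : seq base_row := [::
  (4,8,0,10,12,2,3); (0,9,6,10,13,3,0); (13,4,12,11,6,1,4); (10,6,4,1,5,0,2);
  (9,14,5,7,10,5,3); (12,4,2,14,5,4,4)]%num.

Lemma check_3_0 : check_rows 7 2 7 1 rows_3_0.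
Proof. by vm_compute. Qed.

Definition rows_3_1 : seq base_row := [::
  (6,10,11,4,9,3,0); (15,0,3,9,6,5,5); (12,8,14,4,11,0,0); (0,9,4,12,1,4,3);
  (10,14,5,4,15,2,2); (6,3,5,7,13,1,3)]%num.

Lemma check_3_1 : check_rows 8 2 8 0 rows_3_1.
Proof. by vm_compute. Qed.

Definition rows_4_0 : seq base_row := [::
  (5,16,14,10,3,2,13); (5,6,8,15,12,3,2); (12,6,7,3,11,0,6); (11,14,19,13,6,1,18)]%num.

Lemma check_4_0 : check_rows 19 1 19 1 rows_4_0.
Proof. by vm_compute. Qed.

Definition rows_4_1 : seq base_row := [::
  (1,16,7,18,2,3,15); (12,17,3,0,4,2,6); (9,17,19,15,12,1,15); (19,13,1,12,11,0,6)]%num.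

Lemma check_4_1 : check_rows 21 1 21 0 rows_4_1.
Proof. by vm_compute. Qed.

Definition rows_5_0 : seq base_row := [::
  (6,0,17,8,20,0,12); (18,0,7,16,4,3,10); (16,19,14,21,20,4,16); (3,23,22,14,8,1,14);
  (5,22,24,6,19,2,8)]%num.

Lemma check_5_0 : check_rows 24 1 24 1 rows_5_0.
Proof. by vm_compute. Qed.

Definition rows_5_1 : seq base_row := [::
  (11,0,13,21,7,4,3); (15,0,13,5,19,1,13); (12,11,13,9,16,3,20); (14,5,4,22,15,2,6);
  (15,9,21,4,18,0,23)]%num.

Lemma check_5_1 : check_rows 26 1 26 0 rows_5_1.
Proof. by vm_compute. Qed.

Definition rows_6_0 : seq base_row := [::
  (0,20,6,2,7,2,15); (0,9,23,27,22,5,7); (22,13,17,5,14,0,11); (4,21,7,14,10,4,22);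
  (1,12,9,28,11,3,7); (7,1,29,15,20,1,22)]%num.

Lemma check_6_0 : check_rows 29 1 29 1 rows_6_0.
Proof. by vm_compute. Qed.

Definition rows_6_1 : seq base_row := [::
  (7,9,28,29,12,1,16); (24,22,3,2,19,0,15); (29,15,25,0,7,3,13); (2,16,6,0,24,2,18);
  (14,6,17,10,11,5,28); (20,9,15,28,27,4,3)]%num.

Lemma check_6_1 : check_rows 31 1 31 0 rows_6_1.
Proof. by vm_compute. Qed.

Definition rows_7_0 : seq base_row := [::
  (11,13,15,22,18,2,21); (11,23,31,3,7,4,31); (26,24,11,8,21,0,13); (17,9,2,18,30,5,32);
  (21,20,26,14,9,1,3); (21,11,19,2,22,3,2); (29,20,34,10,9,6,10)]%num.

Lemma check_7_0 : check_rows 34 1 34 1 rows_7_0.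
Proof. by vm_compute. Qed.

Definition rows_7_1 : seq base_row := [::
  (25,20,35,31,7,1,9); (11,16,1,5,29,0,27); (4,7,14,26,31,4,22); (20,1,14,15,17,5,16);
  (17,0,1,28,21,6,29); (29,1,35,15,8,3,20); (35,8,34,31,33,2,27)]%num.

Lemma check_7_1 : check_rows 36 1 36 0 rows_7_1.
Proof. by vm_compute. Qed.

Definition rows_8_0 : seq base_row := [::
  (18,38,30,36,26,2,15); (31,9,24,35,19,5,36); (9,21,15,31,6,0,24); (24,26,0,25,29,6,23);
  (27,16,5,18,25,1,31); (15,12,34,33,26,4,8); (16,3,24,10,19,3,16); (21,5,39,1,6,7,4)]%num.

Lemma check_8_0 : check_rows 39 1 39 1 rows_8_0.
Proof. by vm_compute. Qed.

Definition rows_8_1 : seq base_row := [::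
  (38,7,29,33,0,1,4); (3,34,12,8,0,0,37); (37,27,38,10,35,3,23); (4,14,3,31,6,2,18);
  (25,26,1,19,6,5,10); (16,15,40,22,35,4,31); (29,6,2,17,8,7,13); (34,16,20,5,14,6,28)]%num.

Lemma check_8_1 : check_rows 41 1 41 0 rows_8_1.
Proof. by vm_compute. Qed.

Definition rows_9_0 : seq base_row := [::
  (3,43,28,0,27,7,32); (37,43,10,41,36,4,2); (32,21,13,33,35,3,20); (1,12,14,4,22,2,24);
  (13,6,41,35,3,1,42); (12,39,25,35,0,6,20); (14,30,5,19,37,5,24); (29,38,11,15,9,0,11);
  (33,41,44,28,4,8,13)]%num.

Lemma check_9_0 : check_rows 44 1 44 1 rows_9_0.
Proof. by vm_compute. Qed.

Definition rows_9_1 : seq base_row := [::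
  (5,27,15,26,7,6,29); (41,19,31,20,39,8,40); (17,22,7,25,11,3,39); (29,24,39,21,35,7,30);
  (10,26,33,39,30,5,36); (36,20,13,7,16,4,10); (23,14,39,32,44,0,17); (9,40,38,16,11,2,40);
  (38,24,37,25,6,1,6)]%num.

Lemma check_9_1 : check_rows 46 1 46 0 rows_9_1.
Proof. by vm_compute. Qed.

Definition rows_10_0 : seq base_row := [::
  (48,26,1,14,20,6,48); (32,8,42,7,13,7,44); (40,37,14,4,44,3,22); (22,31,2,48,34,2,27);
  (48,36,15,46,26,9,17); (5,47,6,20,9,8,40); (15,2,47,46,20,0,1); (14,12,47,7,48,1,5);
  (44,35,7,14,3,5,9); (4,45,49,29,47,4,32)]%num.

Lemma check_10_0 : check_rows 49 1 49 1 rows_10_0.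
Proof. by vm_compute. Qed.

Definition rows_10_1 : seq base_row := [::
  (5,33,16,26,30,1,38); (46,18,35,25,21,0,13); (5,4,27,29,13,3,9); (46,47,24,22,38,2,42);
  (1,0,7,12,20,5,1); (50,0,44,39,31,4,50); (49,18,36,15,34,7,16); (2,33,15,36,17,6,35);
  (43,33,4,28,37,9,5); (28,38,16,43,34,8,46)]%num.

Lemma check_10_1 : check_rows 51 1 51 0 rows_10_1.
Proof. by vm_compute. Qed.

Definition rows_11_0 : seq base_row := [::
  (26,2,31,33,32,8,29); (38,28,16,41,22,4,0); (12,15,52,53,32,7,14); (22,45,38,19,40,2,41);
  (2,13,1,28,38,1,0); (51,28,43,47,41,3,6); (41,32,1,46,53,9,35); (1,52,44,37,9,6,45);
  (10,27,51,37,5,0,25); (42,27,31,51,6,5,53); (23,39,54,51,19,10,42)]%num.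

Lemma check_11_0 : check_rows 54 1 54 1 rows_11_0.
Proof. by vm_compute. Qed.

Definition rows_12_0 : seq base_row := [::
  (56,37,6,30,28,7,25); (23,26,41,12,49,9,30); (5,46,12,16,26,8,25); (15,43,57,41,30,5,7);
  (51,39,38,55,15,11,57); (16,57,50,36,49,3,52); (4,38,10,6,46,2,51); (53,18,12,31,15,0,34);
  (55,56,50,46,7,10,37); (17,46,55,52,47,1,5); (56,41,4,29,9,6,25); (51,36,59,41,53,4,2)]%num.

Lemma check_12_0 : check_rows 59 1 59 1 rows_12_0.
Proof. by vm_compute. Qed.

Definition rows_12_1 : seq base_row := [::
  (23,16,18,3,30,3,57); (38,54,44,48,47,6,57); (34,26,17,60,56,9,28); (48,3,20,27,18,0,4);
  (52,2,30,35,55,11,32); (9,35,19,56,20,7,32); (1,25,44,52,48,1,4); (32,16,3,38,5,5,29);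
  (37,58,46,5,34,10,29); (32,50,3,45,2,2,33); (29,8,9,6,44,8,32); (26,1,31,20,43,4,29)]%num.

Lemma check_12_1 : check_rows 61 1 61 0 rows_12_1.
Proof. by vm_compute. Qed.

Definition rows_13_0 : seq base_row := [::
  (13,34,59,52,36,4,19); (9,7,60,39,47,2,34); (38,26,37,35,43,3,35); (63,33,0,2,12,1,57);
  (33,40,37,32,4,0,45); (29,44,45,40,25,12,34); (19,33,7,36,60,7,13); (42,1,13,20,6,6,51);
  (29,59,50,42,15,11,63); (41,63,31,25,45,9,32); (13,39,58,49,19,8,54); (51,60,20,36,14,10,2);
  (55,6,64,45,28,5,30)]%num.

Lemma check_13_0 : check_rows 64 1 64 1 rows_13_0.
Proof. by vm_compute. Qed.

Definition rows_13_1 : seq base_row := [::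
  (41,43,48,27,53,10,58); (47,46,9,30,28,11,15); (24,14,58,2,62,9,7); (24,9,25,45,44,8,61);
  (60,6,45,3,48,6,30); (35,10,33,41,27,12,15); (47,48,39,15,5,2,13); (30,2,55,5,32,4,26);
  (50,30,43,57,61,5,16); (51,7,22,62,2,0,35); (26,65,48,61,35,7,60); (34,42,1,60,31,1,51);
  (12,26,41,7,3,3,17)]%num.

Lemma check_13_1 : check_rows 66 1 66 0 rows_13_1.
Proof. by vm_compute. Qed.

Definition rows_14_0 : seq base_row := [::
  (45,35,68,30,44,1,11); (24,34,1,39,25,0,58); (58,15,42,3,24,12,16); (11,54,27,66,45,5,53);
  (24,4,56,26,20,10,60); (45,65,13,43,49,4,41); (53,55,13,63,60,7,39); (16,14,56,6,9,6,30);
  (53,36,64,13,61,9,20); (16,33,5,56,8,8,49); (20,48,13,33,44,11,26); (56,22,2,28,60,3,17);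
  (43,68,42,18,55,2,53); (19,26,69,20,7,13,6)]%num.

Lemma check_14_0 : check_rows 69 1 69 1 rows_14_0.
Proof. by vm_compute. Qed.

Definition rows_14_1 : seq base_row := [::
  (47,25,9,23,52,3,26); (55,52,57,18,7,6,21); (37,67,56,4,32,8,51); (13,54,70,53,44,0,45);
  (23,3,62,36,30,10,23); (60,52,31,4,56,11,63); (22,36,31,23,16,1,50); (2,37,36,19,48,9,34);
  (2,27,15,24,5,2,20); (58,37,43,2,3,7,37); (66,52,5,7,13,4,48); (62,39,60,32,35,5,8);
  (57,26,44,48,68,13,29); (48,15,68,25,32,12,42)]%num.

Lemma check_14_1 : check_rows 71 1 71 0 rows_14_1.
Proof. by vm_compute. Qed.

Definition rows_15_0 : seq base_row := [::
  (68,51,47,32,1,10,10); (63,52,41,2,34,11,35); (48,24,1,55,47,9,13); (49,64,23,33,63,0,17);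
  (41,44,52,58,12,7,16); (58,36,10,45,31,8,67); (1,21,5,65,52,2,20); (37,28,25,13,66,13,70);
  (59,52,17,57,8,5,7); (15,16,34,42,71,12,32); (16,41,58,38,60,6,37); (13,22,23,17,28,1,39);
  (10,2,23,43,59,4,32); (67,57,69,29,32,3,34); (37,33,74,31,49,14,2)]%num.

Lemma check_15_0 : check_rows 74 1 74 1 rows_15_0.
Proof. by vm_compute. Qed.

Definition rows_15_1 : seq base_row := [::
  (59,67,49,25,36,12,20); (65,22,62,8,57,6,40); (63,61,75,70,23,5,70); (27,44,43,7,49,4,56);
  (64,47,31,5,35,3,20); (0,5,57,18,6,14,18); (50,44,22,70,35,1,36); (46,3,2,30,40,10,16);
  (54,32,62,1,64,9,22); (70,29,25,40,10,8,54); (0,69,51,24,14,7,60); (66,59,34,55,26,13,4);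
  (27,29,47,56,30,0,56); (26,23,51,30,49,11,72); (64,0,55,41,44,2,56)]%num.

Lemma check_15_1 : check_rows 76 1 76 0 rows_15_1.
Proof. by vm_compute. Qed.

Definition rows_16_1 : seq base_row := [::
  (2,9,66,70,38,1,11); (79,72,15,11,43,0,70); (58,73,5,15,61,3,50); (23,8,76,66,20,2,31);
  (39,23,13,57,22,5,62); (42,58,68,24,59,4,19); (4,31,0,67,73,7,35); (77,50,0,14,8,6,46);
  (40,7,18,13,32,9,47); (41,74,63,68,49,8,34); (20,31,78,71,69,11,51); (61,50,3,10,12,10,30);
  (20,75,60,80,36,13,14); (61,6,21,1,45,12,67); (52,23,74,71,73,15,75); (29,58,7,10,8,14,6)]%num.

Lemma check_16_1 : check_rows 81 1 81 0 rows_16_1.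
Proof. by vm_compute. Qed.

Definition rows_17_0 : seq base_row := [::
  (47,81,9,61,36,9,17); (32,19,27,13,80,8,8); (18,60,33,68,63,7,72); (34,53,19,45,12,10,9);
  (37,75,23,17,39,14,59); (56,5,28,47,77,12,15); (56,57,1,54,61,13,75); (5,9,25,80,45,2,12);
  (11,24,71,42,78,1,76); (54,71,38,44,76,0,67); (54,11,35,10,44,3,75); (14,2,43,39,11,15,13);
  (31,13,74,5,44,5,69); (66,65,9,67,27,6,9); (79,58,82,64,42,4,25); (48,62,73,1,83,11,71);
  (51,30,84,47,40,16,67)]%num.

Lemma check_17_0 : check_rows 84 1 84 1 rows_17_0.
Proof. by vm_compute. Qed.

Definition rows_17_1 : seq base_row := [::
  (50,25,46,36,28,10,72); (48,2,24,19,11,2,3); (0,73,47,85,45,14,82); (6,68,59,25,30,7,62);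
  (72,50,66,22,81,6,39); (43,31,79,0,82,9,23); (3,78,42,69,82,15,69); (26,55,54,49,23,3,24);
  (16,23,49,57,24,1,38); (6,24,26,56,8,5,63); (33,70,50,60,16,12,18); (83,68,26,12,31,13,69);
  (84,42,23,12,77,16,78); (46,23,29,43,27,11,17); (53,77,4,26,32,4,40); (32,50,83,9,20,8,26);
  (85,20,45,30,46,0,81)]%num.

Lemma check_17_1 : check_rows 86 1 86 0 rows_17_1.
Proof. by vm_compute. Qed.

Definition rows_20_1 : seq base_row := [::
  (85,59,41,62,32,1,43); (16,42,60,39,69,0,58); (56,90,84,3,92,3,45); (45,11,17,98,9,2,56);
  (79,30,16,39,45,5,8); (22,71,85,62,56,4,93); (53,38,1,42,55,7,91); (48,63,100,59,46,6,10);
  (80,29,87,41,19,9,8); (21,72,14,60,82,8,93); (70,74,12,49,54,11,43); (31,27,89,52,47,10,58);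
  (58,36,23,7,26,13,94); (43,65,78,94,75,12,7); (40,100,23,67,68,15,39); (61,1,78,34,33,14,62);
  (25,79,44,90,20,17,3); (76,22,57,11,81,16,98); (14,6,77,7,32,19,20); (87,95,24,94,69,18,81)]%num.

Lemma check_20_1 : check_rows 101 1 101 0 rows_20_1.
Proof. by vm_compute. Qed.

Definition rows_22_1 : seq base_row := [::
  (42,24,7,16,38,1,66); (69,87,104,95,73,0,45); (83,51,74,26,95,3,23); (28,60,37,85,16,2,88);
  (59,52,18,79,31,5,0); (52,59,93,32,80,4,0); (51,58,91,53,61,7,109); (60,53,20,58,50,6,2);
  (101,56,40,41,37,9,46); (10,55,71,70,74,8,65); (11,55,110,35,57,11,66);
  (100,56,1,76,54,10,45); (38,97,9,87,102,13,24); (73,14,102,24,9,12,87);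
  (17,11,52,103,51,15,28); (94,100,59,8,60,14,83); (21,52,66,10,105,17,73);
  (90,59,45,101,6,16,38); (73,86,37,5,110,19,48); (38,25,74,106,1,18,63);
  (82,14,53,99,25,21,17); (108,65,26,91,54,20,94)]%num.

Lemma check_22_1 : check_rows 111 1 111 0 rows_22_1.
Proof. by vm_compute. Qed.

Definition rows_11_1 : seq base_row := [::
  (16,34,25,13,52,1,39); (35,27,42,51,52,0,17); (55,33,19,29,6,6,46); (10,24,5,51,18,7,16);
  (35,39,28,43,41,5,29); (2,39,21,14,55,4,27); (41,11,16,39,7,2,10); (20,8,50,19,22,3,40);
  (11,28,47,12,23,9,17); (17,11,50,16,37,10,22); (13,16,5,45,51,8,49)]%num.

Lemma check_11_1 : check_rows 56 1 56 0 rows_11_1.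
Proof. by vm_compute. Qed.

Definition rows_16_0 : seq base_row := [::
  (43,27,63,10,37,1,28); (53,47,69,9,61,0,51); (78,43,50,32,66,9,41); (62,57,64,18,43,6,74);
  (71,61,13,45,69,15,17); (58,67,62,38,37,12,29); (63,62,67,29,20,3,5); (41,11,28,59,39,8,30);
  (60,11,50,23,65,7,49); (54,51,9,2,77,2,38); (16,28,34,56,73,13,45); (59,72,44,65,36,14,26);
  (8,9,52,28,11,5,50); (2,49,59,62,50,10,34); (46,33,42,71,57,11,53); (28,75,79,25,10,4,62)]%num.

Lemma check_16_0 : check_rows 79 1 79 1 rows_16_0.
Proof. by vm_compute. Qed.

Definition rows_20_0 : seq base_row := [::
  (66,77,29,89,63,12,23); (33,36,4,69,58,5,25); (92,40,28,21,69,0,91); (63,98,1,45,18,7,20);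
  (63,76,27,28,55,15,87); (31,11,8,71,69,3,70); (90,2,21,6,11,9,49); (95,78,43,38,83,6,32);
  (94,90,9,53,84,18,46); (32,39,71,52,88,1,35); (77,26,8,79,53,11,17); (90,9,12,43,41,14,1);
  (81,28,54,43,49,10,74); (81,95,82,39,51,16,42); (36,88,32,42,11,8,57); (55,40,39,63,33,4,12);
  (73,53,39,11,77,13,57); (0,25,41,16,8,17,83); (29,36,20,7,62,2,8); (48,58,99,97,57,19,60)]%num.

Lemma check_20_0 : check_rows 99 1 99 1 rows_20_0.
Proof. by vm_compute. Qed.

Definition rows_22_0 : seq base_row := [::
  (78,101,27,36,37,8,12); (10,36,25,74,101,5,66); (37,17,50,46,100,10,86);
  (84,63,69,91,53,17,85); (98,16,46,103,19,11,59); (102,33,79,53,14,15,101);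
  (73,75,89,14,67,12,7); (107,47,52,83,40,16,22); (47,62,99,24,15,0,97);
  (33,99,105,37,8,19,81); (86,97,55,69,73,1,61); (66,39,63,19,38,4,50);
  (76,47,105,60,7,14,105); (100,89,27,59,82,21,78); (34,0,51,106,94,6,20);
  (87,41,73,74,39,18,43); (91,30,25,20,28,7,87); (63,87,108,73,89,3,24);
  (32,105,31,101,84,20,73); (105,24,18,55,97,9,28); (76,8,28,67,84,2,100);
  (90,58,109,97,0,13,31)]%num.

Lemma check_22_0 : check_rows 109 1 109 1 rows_22_0.
Proof. by vm_compute. Qed.

(** * Base blocks of cyclic group divisible designs *)

Definition rows_18 : seq base_row := [::
  (60,69,31,4,59,5,23); (26,84,23,10,31,12,24); (10,83,43,2,72,13,74); (21,88,74,25,77,14,4);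
  (77,48,63,55,8,1,54); (23,46,37,63,42,3,25); (15,66,35,79,46,10,27); (3,50,48,25,35,4,85);
  (1,81,72,74,88,9,55); (19,17,21,54,76,8,35); (39,78,73,86,11,11,80); (30,68,71,88,49,2,78);
  (51,44,7,76,17,6,41); (59,9,54,55,8,7,5); (47,73,21,48,32,0,42)]%num.

Lemma check_18 : check_rows 90 1 6 0 rows_18.
Proof. by vm_compute. Qed.

Definition rows_19 : seq base_row := [::
  (5,68,75,66,57,1,73); (70,7,76,9,18,0,2); (11,8,77,59,2,3,19); (64,67,78,16,73,2,56);
  (53,26,79,52,60,5,4); (22,49,80,23,15,4,71); (63,32,81,45,61,7,20); (12,43,82,30,14,6,55);
  (7,66,83,44,33,9,73); (68,9,84,31,42,8,2); (5,41,85,13,19,11,46); (70,34,86,62,56,10,29);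
  (28,31,87,27,74,13,59); (47,44,88,48,1,12,16); (24,56,89,63,5,15,5); (51,19,90,12,70,14,70);
  (17,54,91,58,71,17,71); (58,21,92,17,4,16,4); (69,15,93,57,38,19,9); (6,60,94,18,37,18,66)]%num.

Lemma check_19 : check_rows 75 1 5 20 rows_19.
Proof. by vm_compute. Qed.

Definition rows_21 : seq base_row := [::
  (56,67,73,2,20,1,18); (49,38,32,103,85,0,87); (4,94,70,51,78,3,98); (101,11,35,54,27,2,7);
  (69,5,49,100,43,5,74); (36,100,56,5,62,4,31); (22,26,25,98,3,7,48); (83,79,80,7,102,6,57);
  (1,94,34,98,39,9,95); (104,11,71,7,66,8,10); (103,102,34,87,43,11,100); (2,3,71,18,62,10,5);
  (87,90,22,9,11,13,72); (18,15,83,96,94,12,33); (104,81,19,1,49,15,80);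
  (1,24,86,104,56,14,25); (28,58,33,67,45,17,86); (77,47,72,38,60,16,19)]%num.

Lemma check_21 : check_rows 105 1 7 0 rows_21.
Proof. by vm_compute. Qed.

Definition rows_23 : seq base_row := [::
  (8,16,70,22,39,3,37); (26,82,38,4,65,7,17); (61,89,50,83,7,12,77); (41,42,60,33,79,0,63);
  (39,81,32,80,43,17,70); (93,22,96,59,80,10,19); (17,66,50,59,93,19,96);
  (87,21,100,89,30,1,83); (45,24,101,71,22,16,61); (7,20,102,36,8,9,84); (3,74,103,86,60,5,81);
  (92,78,104,60,56,18,67); (12,84,105,71,38,2,23); (36,72,106,74,80,13,98);
  (51,45,107,58,27,21,41); (14,50,108,46,53,15,4); (33,57,109,61,10,8,39);
  (11,69,110,28,92,4,30); (14,58,111,11,25,11,33); (63,54,112,52,51,6,4);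
  (57,78,113,49,30,20,29); (86,17,114,33,65,14,59)]%num.

Lemma check_23 : check_rows 100 1 5 15 rows_23.
Proof. by vm_compute. Qed.

Definition rows_24 : seq base_row := [::
  (74,54,67,33,58,1,8); (46,66,53,87,62,0,112); (105,109,18,65,56,3,94);
  (15,11,102,55,64,2,26); (17,118,25,86,18,5,15); (103,2,95,34,102,4,105);
  (38,19,83,52,6,7,57); (82,101,37,68,114,6,63); (84,22,7,62,21,9,106); (36,98,113,58,99,8,14);
  (111,40,61,35,38,11,31); (9,80,59,85,82,10,89); (17,69,54,52,79,13,86);
  (103,51,66,68,41,12,34); (28,39,103,98,0,15,67); (92,81,17,22,0,14,53);
  (32,67,118,21,29,17,99); (88,53,2,99,91,16,21); (21,47,84,112,31,19,68);
  (99,73,36,8,89,18,52)]%num.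

Lemma check_24 : check_rows 120 1 6 0 rows_24.
Proof. by vm_compute. Qed.

Definition rows_26 : seq base_row := [::
  (63,11,83,2,12,18,48); (40,18,16,8,63,20,102); (8,56,34,86,80,3,55); (1,58,105,89,76,2,50);
  (71,45,106,98,30,4,52); (76,84,107,101,46,5,88); (26,78,108,23,35,15,70);
  (35,95,109,3,96,7,92); (32,75,110,57,38,8,18); (61,58,111,14,80,19,54);
  (85,17,112,46,77,10,76); (17,37,113,60,35,11,82); (37,76,114,33,42,12,43);
  (8,41,115,24,82,13,17); (79,31,116,53,82,14,83); (70,58,117,47,85,6,35);
  (70,54,118,66,65,16,93); (69,72,119,5,74,17,67); (3,81,120,35,68,0,57);
  (83,63,121,26,65,9,51); (90,84,122,11,19,1,3); (13,87,123,12,28,24,10);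
  (13,67,124,103,2,22,69); (72,31,125,12,22,23,19); (12,56,126,18,2,21,95);
  (86,50,127,97,63,25,58); (20,37,128,96,56,26,46); (69,64,129,40,44,27,24)]%num.

Lemma check_26 : check_rows 105 1 7 25 rows_26.
Proof. by vm_compute. Qed.

Definition rows_27 : seq base_row := [::
  (64,98,105,17,65,1,57); (41,7,106,88,40,0,48); (7,61,107,36,97,3,68); (98,44,108,69,8,2,37);
  (88,96,109,44,91,5,79); (17,9,110,61,14,4,26); (94,12,111,15,74,7,1);
  (11,93,112,90,31,6,104); (52,35,113,95,26,9,87); (53,70,114,10,79,8,18);
  (78,77,115,67,13,11,50); (27,28,116,38,92,10,55); (86,54,117,41,45,13,35);
  (19,51,118,64,60,12,70); (31,25,119,54,56,15,56); (74,80,120,51,49,14,49);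
  (32,10,121,49,44,17,42); (73,95,122,56,61,16,63); (58,95,123,77,45,19,48);
  (47,10,124,28,60,18,57); (38,103,125,8,76,21,36); (67,2,126,97,29,20,69);
  (42,23,127,101,90,23,65); (63,82,128,4,15,22,40); (33,53,129,83,0,25,86);
  (72,52,130,22,0,24,19); (79,81,131,97,85,27,55); (26,24,132,8,20,26,50);
  (73,65,133,49,34,29,33); (32,40,134,56,71,28,72)]%num.

Lemma check_27 : check_rows 105 1 7 30 rows_27.
Proof. by vm_compute. Qed.

Definition rows_31 : seq base_row := [::
  (55,106,94,42,98,1,26); (80,29,41,93,37,0,109); (112,48,72,78,62,3,25);
  (23,87,63,57,73,2,110); (44,59,117,91,120,5,103); (91,76,18,44,15,4,32);
  (103,36,74,91,84,7,4); (32,99,61,44,51,6,131); (102,58,107,0,115,9,25);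
  (33,77,28,0,20,8,110); (13,102,134,61,81,11,115); (122,33,1,74,54,10,20);
  (58,83,135,27,62,13,6); (77,52,136,108,73,12,129); (8,132,137,14,97,15,5);
  (127,3,138,121,38,14,130); (111,29,139,104,127,17,5); (24,106,140,31,8,16,130);
  (15,109,141,107,14,19,124); (120,26,142,28,121,18,11); (116,85,143,83,5,21,66);
  (19,50,144,52,130,20,69); (42,86,145,12,108,23,128); (93,49,146,123,27,22,7);
  (45,3,147,50,110,25,48); (90,132,148,85,25,24,87); (5,106,149,30,8,27,111);
  (130,29,150,105,127,26,24); (43,42,151,112,93,29,85); (92,93,152,23,42,28,50);
  (18,104,153,115,130,31,122); (117,31,154,20,5,30,13)]%num.

Lemma check_31 : check_rows 135 1 9 20 rows_31.
Proof. by vm_compute. Qed.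

Definition rows_32 : seq base_row := [::
  (92,109,47,21,24,1,61); (48,31,93,119,116,0,79); (41,122,9,22,56,3,23);
  (99,18,131,118,84,2,117); (23,132,47,22,38,5,15); (117,8,93,118,102,4,125);
  (66,126,9,138,85,7,52); (74,14,131,2,55,6,88); (10,54,11,15,44,9,64);
  (130,86,129,125,96,8,76); (99,26,34,136,130,11,125); (41,114,106,4,10,10,15);
  (110,94,140,132,106,13,64); (30,46,141,8,34,12,76); (86,129,142,83,81,15,75);
  (54,11,143,57,59,14,65); (83,1,144,130,63,17,84); (57,139,145,10,77,16,56);
  (66,111,146,7,86,19,37); (74,29,147,133,54,18,103); (78,2,148,24,41,21,80);
  (62,138,149,116,99,20,60); (72,137,150,66,48,23,69); (68,3,151,74,92,22,71);
  (5,63,152,45,55,25,68); (135,77,153,95,85,24,72); (118,116,154,5,66,27,94);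
  (22,24,155,135,74,26,46); (90,99,156,39,7,29,49); (50,41,157,101,133,28,91);
  (137,104,158,50,63,31,101); (3,36,159,90,77,30,39)]%num.

Lemma check_32 : check_rows 140 1 7 20 rows_32.
Proof. by vm_compute. Qed.

Definition rows_33 : seq base_row := [::
  (52,38,102,50,42,1,90); (83,97,33,85,93,0,45); (134,36,69,129,29,3,35);
  (1,99,66,6,106,2,100); (110,42,59,36,62,5,17); (25,93,76,99,73,4,118); (92,43,135,90,3,7,0);
  (43,92,136,45,132,6,0); (103,12,137,126,23,9,115); (32,123,138,9,112,8,20);
  (87,52,139,83,68,11,4); (48,83,140,52,67,10,131); (4,66,141,41,10,13,70);
  (131,69,142,94,125,12,65); (65,3,143,72,116,15,68); (70,132,144,63,19,14,67);
  (48,116,145,20,73,17,29); (87,19,146,115,62,16,106); (22,69,147,99,23,19,91);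
  (113,66,148,36,112,18,44); (101,98,149,88,122,21,64); (34,37,150,47,13,20,71);
  (116,66,151,23,82,23,47); (19,69,152,112,53,22,88); (79,23,153,92,120,25,102);
  (56,112,154,43,15,24,33); (117,116,155,105,97,27,98); (18,19,156,30,38,26,37);
  (26,123,157,52,84,29,14); (109,12,158,83,51,28,121); (95,66,159,42,9,31,26);
  (40,69,160,93,126,30,109); (45,86,161,115,100,33,131); (90,49,162,20,35,32,4);
  (121,60,163,3,8,35,46); (14,75,164,132,127,34,89)]%num.

Lemma check_33 : check_rows 135 1 9 30 rows_33.
Proof. by vm_compute. Qed.

Definition rows_34 : seq base_row := [::
  (142,18,49,131,20,1,10); (8,132,101,19,130,0,140); (92,143,84,40,106,3,85);
  (58,7,66,110,44,2,65); (101,5,17,114,8,5,106); (49,145,133,36,142,4,44);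
  (22,126,109,28,105,7,148); (128,24,41,122,45,6,2); (108,30,109,66,122,9,138);
  (42,120,41,84,28,8,12); (126,118,45,54,22,11,94); (24,32,105,96,128,10,56);
  (138,97,150,55,131,13,85); (12,53,151,95,19,12,65); (148,1,152,125,132,15,149);
  (2,149,153,25,18,14,1); (136,37,154,19,108,17,23); (14,113,155,131,42,16,127);
  (46,44,156,10,63,19,90); (104,106,157,140,87,18,60); (120,31,158,64,2,21,1);
  (30,119,159,86,148,20,149); (63,41,160,14,62,23,104); (87,109,161,136,88,22,46);
  (86,62,162,4,80,25,148); (64,88,163,146,70,24,2); (87,44,164,56,40,27,131);
  (63,106,165,94,110,26,19); (27,38,166,65,129,29,65); (123,112,167,85,21,28,85);
  (27,76,168,139,115,31,103); (123,74,169,11,35,30,47)]%num.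

Lemma check_34 : check_rows 150 1 5 20 rows_34.
Proof. by vm_compute. Qed.

Definition rows_36 : seq base_row := [::
  (8,23,140,75,77,1,31); (132,117,141,65,63,0,109); (76,2,142,1,54,3,78);
  (64,138,143,139,86,2,62); (139,128,144,46,82,5,127); (1,12,145,94,58,4,13);
  (5,60,146,111,43,7,65); (135,80,147,29,97,6,75); (1,34,148,129,28,9,35);
  (139,106,149,11,112,8,105); (5,43,150,108,39,11,48); (135,97,151,32,101,10,92);
  (25,16,152,106,133,13,41); (115,124,153,34,7,12,99); (81,52,154,128,112,15,133);
  (59,88,155,12,28,14,7); (15,18,156,58,76,17,33); (125,122,157,82,64,16,107);
  (105,15,158,51,95,19,120); (35,125,159,89,45,18,20); (60,139,160,108,82,21,59);
  (80,1,161,32,58,20,81); (32,14,162,24,37,23,46); (108,126,163,116,103,22,94);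
  (122,67,164,1,82,25,49); (18,73,165,139,58,24,91); (22,33,166,63,111,27,55);
  (118,107,167,77,29,26,85); (33,1,168,46,27,29,34); (107,139,169,94,113,28,106);
  (58,38,170,91,62,31,96); (82,102,171,49,78,30,44); (84,22,172,20,59,33,106);
  (56,118,173,120,81,32,34); (60,106,174,65,90,35,26); (80,34,175,75,50,34,114);
  (86,89,176,77,69,37,35); (54,51,177,63,71,36,105); (99,100,178,3,27,39,59);
  (41,40,179,137,113,38,81)]%num.

Lemma check_36 : check_rows 140 1 7 40 rows_36.
Proof. by vm_compute. Qed.

Definition rows_37 : seq base_row := [::
  (110,119,80,96,67,1,64); (55,46,85,69,98,0,101); (80,162,142,71,138,3,77);
  (85,3,23,94,27,2,88); (41,5,145,58,73,5,46); (124,160,20,107,92,4,119);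
  (86,159,161,113,61,7,80); (79,6,4,52,104,6,85); (35,94,151,97,59,9,129);
  (130,71,14,68,106,8,36); (1,51,5,152,13,11,52); (164,114,160,13,152,10,113);
  (92,93,162,36,62,13,20); (73,72,3,129,103,12,145); (74,93,121,116,53,15,2);
  (91,72,44,49,112,14,163); (136,54,5,18,99,17,25); (29,111,160,147,66,16,140);
  (2,127,165,164,86,19,129); (163,38,166,1,79,18,36); (139,85,167,43,104,21,59);
  (26,80,168,122,61,20,106); (22,117,169,37,97,23,139); (143,48,170,128,68,22,26);
  (19,131,171,29,17,25,150); (146,34,172,136,148,24,15); (70,126,173,118,75,27,31);
  (95,39,174,47,90,26,134); (48,3,175,19,79,29,51); (117,162,176,146,86,28,114);
  (144,20,177,126,94,31,164); (21,145,178,39,71,30,1); (67,73,179,66,39,33,140);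
  (98,92,180,99,126,32,25); (23,30,181,102,13,35,53); (142,135,182,63,152,34,112);
  (38,139,183,118,32,37,12); (127,26,184,47,133,36,153)]%num.

Lemma check_37 : check_rows 165 1 11 20 rows_37.
Proof. by vm_compute. Qed.

(** * Base blocks of group divisible designs of type 5^k *)

Definition rows_g5 : seq base_row := [::
  (6,18,11,2,23,13,3); (15,11,23,3,7,11,0); (16,5,20,13,1,17,4); (21,9,4,11,15,1,0);
  (12,9,22,17,2,6,3); (14,4,7,16,20,12,2); (13,22,4,19,5,4,2); (17,6,22,3,11,8,3);
  (22,18,6,13,0,7,2); (8,12,22,1,19,0,4); (4,22,14,18,8,16,2); (10,6,16,3,23,10,3);
  (3,19,5,21,11,9,4); (9,4,13,18,24,15,4); (0,10,18,24,5,5,1); (23,17,11,0,5,14,4);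
  (1,9,23,16,12,3,1); (21,6,19,0,12,2,1); (19,3,14,22,9,19,2); (3,20,12,5,15,18,3)]%num.

Lemma check_g5 : check_rows 5 5 1 0 rows_g5.
Proof. by vm_compute. Qed.

Definition rows_g6 : seq base_row := [::
  (19,26,10,22,8,19,1); (24,2,15,27,13,6,2); (29,7,20,3,18,21,1); (0,12,25,8,23,8,2);
  (5,17,1,13,28,25,4); (10,22,6,18,4,12,3); (1,21,11,25,5,7,4); (6,26,16,1,10,13,0);
  (11,2,21,6,15,3,3); (16,7,26,11,20,4,3); (21,12,2,16,25,11,4); (26,17,7,21,1,0,4);
  (8,24,25,11,16,5,2); (13,29,1,16,21,29,1); (18,0,6,21,26,24,2); (23,5,11,26,2,9,0);
  (28,10,16,2,7,10,0); (4,15,21,7,12,27,2); (25,15,3,9,20,28,2); (1,20,8,14,25,22,2);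
  (6,25,13,19,1,23,2); (11,1,18,24,6,18,3); (16,6,23,29,11,26,3); (21,11,28,0,16,20,3);
  (17,10,27,24,9,14,3); (22,15,3,29,14,15,3); (27,20,8,0,19,16,3); (3,25,13,5,24,17,3);
  (8,1,18,10,29,1,2); (13,6,23,15,0,2,2)]%num.

Lemma check_g6 : check_rows 5 6 1 0 rows_g6.
Proof. by vm_compute. Qed.

Definition rows_g7 : seq base_row := [::
  (2,19,21,13,33,13,3); (7,24,26,18,4,7,4); (12,29,31,23,9,8,4); (17,34,2,28,14,9,4);
  (22,0,7,33,19,10,4); (27,5,12,4,24,11,4); (32,10,17,9,29,12,4); (20,8,14,3,18,1,1);
  (25,13,19,8,23,2,1); (30,18,24,13,28,3,1); (1,23,29,18,33,4,1); (6,28,34,23,4,5,1);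
  (11,33,0,28,9,6,1); (16,4,5,33,14,0,2); (21,18,8,11,34,19,4); (26,23,13,16,0,17,0);
  (31,28,18,21,5,14,0); (2,33,23,26,10,15,0); (7,4,28,31,15,28,0); (12,9,33,2,20,40,1);
  (17,14,4,7,25,21,3); (6,31,15,1,11,41,2); (11,2,20,6,16,29,0); (16,7,25,11,21,30,0);
  (21,12,30,16,26,31,0); (26,17,1,21,31,38,3); (31,22,6,26,2,39,3); (2,27,11,31,7,34,0);
  (29,15,31,3,8,18,0); (34,20,2,8,13,22,0); (0,25,7,13,18,23,0); (5,30,12,18,23,24,0);
  (10,1,17,23,28,35,2); (15,6,22,28,33,36,2); (20,11,27,33,4,37,2); (17,20,4,13,32,32,3);
  (22,25,9,18,3,33,3); (27,30,14,23,8,16,4); (32,1,19,28,13,25,2); (3,6,24,33,18,26,2);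
  (8,11,29,4,23,27,2); (13,16,34,9,28,20,4)]%num.

Lemma check_g7 : check_rows 5 7 1 0 rows_g7.
Proof. by vm_compute. Qed.

Definition rows_g8 : seq base_row := [::
  (33,4,15,11,35,11,4); (38,9,20,16,1,44,3); (4,14,25,21,6,13,4); (9,19,30,26,11,46,3);
  (14,24,35,31,16,9,2); (19,29,1,36,21,8,0); (24,34,6,2,26,41,4); (29,39,11,7,31,10,0);
  (11,1,29,33,9,2,2); (16,6,34,38,14,0,3); (21,11,39,4,19,1,3); (26,16,0,9,24,6,3);
  (31,21,5,14,29,7,3); (36,26,10,19,34,4,3); (2,31,15,24,39,55,4); (7,36,20,29,0,48,0);
  (21,34,16,28,5,24,0); (26,39,21,33,10,25,0); (31,0,26,38,15,26,0); (36,5,31,4,20,42,4);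
  (2,10,36,9,25,28,0); (7,15,2,14,30,27,4); (12,20,7,19,35,30,0); (17,25,12,24,1,29,4);
  (23,10,28,16,39,18,1); (28,15,33,21,0,23,3); (33,20,38,26,5,16,4); (38,25,4,31,10,17,4);
  (4,30,9,36,15,22,1); (9,35,14,2,20,21,0); (14,1,19,7,25,32,4); (19,6,24,12,30,33,4);
  (26,8,20,14,39,47,1); (31,13,25,19,0,31,1); (36,18,30,24,5,49,3); (2,23,35,29,10,50,3);
  (7,28,1,34,15,43,2); (12,33,6,39,20,52,3); (17,38,11,0,25,53,3); (22,4,16,5,30,54,3);
  (20,11,34,25,15,5,1); (25,16,39,30,20,34,3); (30,21,0,35,25,19,1); (35,26,5,1,30,20,1);
  (1,31,10,6,35,37,3); (6,36,15,11,1,38,3); (11,2,20,16,6,3,2); (16,7,25,21,11,51,4);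
  (36,7,24,16,27,15,0); (2,12,29,21,32,45,1); (7,17,34,26,37,35,2); (12,22,39,31,3,36,2);
  (17,27,0,36,8,40,2); (22,32,5,2,13,12,1); (27,37,10,7,18,39,2); (32,3,15,12,23,14,1)]%num.

Lemma check_g8 : check_rows 5 8 1 0 rows_g8.
Proof. by vm_compute. Qed.

(** * Recursion *)

Lemma eqn_mod_coprime m d i j : coprime m d -> i < m -> j < m ->
  d * i = d * j %[mod m] -> i = j.
Proof.
move=> md; wlog ji : i j / j <= i => [W im jm E|im jm].
  by case/orP: (leq_total i j) => le; [apply/esym; apply: W | apply: W].
move/eqP; rewrite eqn_mod_dvd ?leq_mul2l ?ji ?orbT // -mulnBr Gauss_dvdr // -eqn_mod_dvd //.
by rewrite !modn_small // => /eqP.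
Qed.

Section Linear.
Variables (k m : nat).
Hypothesis m_gt0 : 0 < m.

(* The line [l = i * m + j] has row [i + c * j] in column [c], and its slope [j] in the last
   column. *)
Definition linear_line (l c : nat) : nat :=
  if c == k.-1 then l %% m else (l %/ m + c * (l %% m)) %% m.

Lemma linear_line_lt l c : linear_line l c < m.
Proof. by rewrite /linear_line; case: eqP; rewrite ltn_mod. Qed.

(** Two of the first columns differ by [(c' - c) * j], which determines the slope [j] because
    [c' - c] is invertible modulo [m]; the last column gives the slope outright. The slope and one
    other column then give the intercept [i]. *)
Lemma linear_line_inj : (forall d, 0 < d < k.-1 -> coprime m d) ->
  forall c c' l l', c < c' < k -> l < m * m -> l' < m * m ->
  linear_line l c = linear_line l' c -> linear_line l c' = linear_line l' c' -> l = l'.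
Proof.
move=> cop c c' l l' /andP[cc' ck] lm lm'; rewrite /linear_line.
have -> : (c == k.-1) = false by lia.
have im : l %/ m < m by rewrite ltn_divLR.
have im' : l' %/ m < m by rewrite ltn_divLR.
have fin : l %% m = l' %% m ->
    l %/ m + c * (l %% m) = l' %/ m + c * (l' %% m) %[mod m] -> l = l'.
  move=> Ej /eqP; rewrite Ej eqn_modDr !modn_small // => /eqP Ei.
  by rewrite (divn_eq l m) (divn_eq l' m) Ei Ej.
case: (c' =P k.-1) => [_ E E'|ck' E E']; first exact: fin.
apply: fin => //; apply: (@eqn_mod_coprime m (c' - c)); rewrite ?ltn_mod //.
  by apply: cop; lia.
have D a j : a + c' * j = a + c * j + (c' - c) * j by rewrite -addnA -mulnDl subnKC // ltnW.
move: E'; rewrite !D -(modnDml (l %/ m + _)) E modnDml => /eqP.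
by rewrite eqn_modDl => /eqP.
Qed.
End Linear.

(* The line [y = i + c j] over the field with nine elements, [3 a + b] standing for
   [a i + b] with [i ^ 2 = -1]. *)
Definition gf9_line (l c : nat) : nat :=
  let: (i, j) := (l %/ 9, l %% 9) in
  3 * ((i %/ 3 + c %/ 3 * (j %% 3) + c %% 3 * (j %/ 3)) %% 3)
  + (i %% 3 + c %% 3 * (j %% 3) + 2 * (c %/ 3 * (j %/ 3))) %% 3.

Lemma uniq_map_inj (T U : eqType) (g : T -> U) s : uniq (map g s) -> {in s &, injective g}.
Proof.
elim: s => //= x s IH /andP[/mapP gx us] y z; rewrite !inE.
case/orP => [/eqP->|ys] /orP[/eqP->|zs] //; last exact: IH.
- by move=> E; case: gx; exists z.
- by move=> E; case: gx; exists y.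
Qed.

Lemma gf9_line_lt l c : gf9_line l c < 9.
Proof. by rewrite /gf9_line; have := ltn_mod; lia. Qed.

(** A finite verification: for each two of the seven columns, the pairs of rows of the 81 lines,
    encoded in base 9, are all distinct. *)
Lemma gf9_line_inj c c' l l' : c < c' < 7 -> l < 9 * 9 -> l' < 9 * 9 ->
  gf9_line l c = gf9_line l' c -> gf9_line l c' = gf9_line l' c' -> l = l'.
Proof.
pose codes c c' := [seq 9 * gf9_line l c + gf9_line l c' | l <- iota 0 81].
have H : all (fun c' => all (fun c => uniq (codes c c')) (iota 0 c')) (iota 0 7).
  by vm_compute.
move=> /andP[cc' c7] lm lm' E E'.
have := allP (allP H c' _) c _; rewrite !mem_iota => /(_ c7 cc') /uniq_map_inj; apply.
- by rewrite mem_iota.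
- by rewrite mem_iota.
- by rewrite E E'.
Qed.
(** The two residues are treated together: a point at infinity is handed on unchanged to every
    group, so the recursion in [n] is the same for both. *)
Definition good5 (n : nat) : Prop := forall e : bool, good_order (5 * n + e).

Lemma good_order_rows (n r t w cls : N) (d : seq base_row) (e : bool) (v : nat) :
  (0 < t)%num -> (0 < cls)%num -> n = (cls * t)%num -> check_rows n r t w d ->
  v = N.to_nat (r * n + w) + e ->
  good_order (N.to_nat cls + e) -> good_order (N.to_nat w + e) -> good_order v.
Proof. by move=> t0 c0 nE chk ->; exact: (good_order_check t0 c0 nE chk). Qed.

(** With [t = n] each moving point is a group by itself, and so is a single fixed point if there is
    one. Nothing is left to fill, and the group divisible design is already a design. *)
Lemma good_order_check1 (n r w : N) (d : seq base_row) (v : nat) :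
  check_rows n r n w d -> N.ltb 0 n -> N.leb w 1 -> v == N.to_nat (r * n + w) -> good_order v.
Proof.
move=> chk /N.ltb_spec0 n0 /N.leb_spec0 w1 /eqP vE.
apply: (good_order_rows (e := false) (cls := 1%num) n0 _ _ chk); rewrite ?addn0 //.
- by rewrite N.mul_1_l.
- exact: good_order_le1.
- by apply: good_order_le1; lia.
Qed.

(** This is what allows a column to be truncated to nothing, and a group divisible design to have no
    fixed points. *)
Lemma good5_0 : good5 0.
Proof. by move=> e; apply: good_order_le1; case: e. Qed.

(** One group divisible design settles both residues, since [e] enters only through the filling of
    its groups of [5 * a] and [5 * b] points. *)
Lemma good5_fill (n t w : N) (d : seq base_row) (a b v : nat) :
  check_rows n 1 t w d -> good5 a -> good5 b ->
  [&& N.ltb 0 t, 0 < a, n == N.mul (N.of_nat (5 * a)) t, w == N.of_nat (5 * b)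
    & 5 * v == N.to_nat (n + w)] -> good5 v.
Proof.
move=> chk ga gb /and5P[/N.ltb_spec0 t0 a0 /eqP nE /eqP wE /eqP vE] e.
apply: (good_order_rows t0 _ nE chk).
- lia.
- by rewrite vE N.mul_1_l.
- by rewrite Nnat.Nat2N.id; apply: ga.
- by rewrite wE Nnat.Nat2N.id; apply: gb.
Qed.

(** * Small values settled by explicit base blocks *)

Lemma good5_3 : good5 3.
Proof.
(* The case [e = true] comes first, hence the design with the additional point. *)
by case; [apply: (good_order_check1 check_3_1) | apply: (good_order_check1 check_3_0)].
Qed.

Lemma good5_4 : good5 4.
Proof.
by case; [apply: (good_order_check1 check_4_1) | apply: (good_order_check1 check_4_0)].
Qed.

Lemma good5_5 : good5 5.
Proof.
by case; [apply: (good_order_check1 check_5_1) | apply: (good_order_check1 check_5_0)].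
Qed.

Lemma good5_6 : good5 6.
Proof.
by case; [apply: (good_order_check1 check_6_1) | apply: (good_order_check1 check_6_0)].
Qed.

Lemma good5_7 : good5 7.
Proof.
by case; [apply: (good_order_check1 check_7_1) | apply: (good_order_check1 check_7_0)].
Qed.

Lemma good5_8 : good5 8.
Proof.
by case; [apply: (good_order_check1 check_8_1) | apply: (good_order_check1 check_8_0)].
Qed.

Lemma good5_9 : good5 9.
Proof.
by case; [apply: (good_order_check1 check_9_1) | apply: (good_order_check1 check_9_0)].
Qed.

Lemma good5_10 : good5 10.
Proof.
by case; [apply: (good_order_check1 check_10_1) | apply: (good_order_check1 check_10_0)].
Qed.

Lemma good5_11 : good5 11.
Proof.
by case; [apply: (good_order_check1 check_11_1) | apply: (good_order_check1 check_11_0)].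
Qed.

Lemma good5_12 : good5 12.
Proof.
by case; [apply: (good_order_check1 check_12_1) | apply: (good_order_check1 check_12_0)].
Qed.

Lemma good5_13 : good5 13.
Proof.
by case; [apply: (good_order_check1 check_13_1) | apply: (good_order_check1 check_13_0)].
Qed.

Lemma good5_14 : good5 14.
Proof.
by case; [apply: (good_order_check1 check_14_1) | apply: (good_order_check1 check_14_0)].
Qed.

Lemma good5_15 : good5 15.
Proof.
by case; [apply: (good_order_check1 check_15_1) | apply: (good_order_check1 check_15_0)].
Qed.

Lemma good5_16 : good5 16.
Proof.
by case; [apply: (good_order_check1 check_16_1) | apply: (good_order_check1 check_16_0)].
Qed.

Lemma good5_17 : good5 17.
Proof.
by case; [apply: (good_order_check1 check_17_1) | apply: (good_order_check1 check_17_0)].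
Qed.

Lemma good5_18 : good5 18.
Proof. by apply: (good5_fill check_18 good5_3 good5_0). Qed.

Lemma good5_19 : good5 19.
Proof. by apply: (good5_fill check_19 good5_3 good5_4). Qed.

Lemma good5_20 : good5 20.
Proof.
by case; [apply: (good_order_check1 check_20_1) | apply: (good_order_check1 check_20_0)].
Qed.

Lemma good5_21 : good5 21.
Proof. by apply: (good5_fill check_21 good5_3 good5_0). Qed.

Lemma good5_22 : good5 22.
Proof.
by case; [apply: (good_order_check1 check_22_1) | apply: (good_order_check1 check_22_0)].
Qed.

Lemma good5_23 : good5 23.
Proof. by apply: (good5_fill check_23 good5_4 good5_3). Qed.

Lemma good5_24 : good5 24.
Proof. by apply: (good5_fill check_24 good5_4 good5_0). Qed.

Lemma good5_26 : good5 26.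
Proof. by apply: (good5_fill check_26 good5_3 good5_5). Qed.

Lemma good5_27 : good5 27.
Proof. by apply: (good5_fill check_27 good5_3 good5_6). Qed.

Lemma good5_31 : good5 31.
Proof. by apply: (good5_fill check_31 good5_3 good5_4). Qed.

Lemma good5_32 : good5 32.
Proof. by apply: (good5_fill check_32 good5_4 good5_4). Qed.

Lemma good5_33 : good5 33.
Proof. by apply: (good5_fill check_33 good5_3 good5_6). Qed.

Lemma good5_34 : good5 34.
Proof. by apply: (good5_fill check_34 good5_6 good5_4). Qed.

Lemma good5_36 : good5 36.
Proof. by apply: (good5_fill check_36 good5_4 good5_8). Qed.

Lemma good5_37 : good5 37.
Proof. by apply: (good5_fill check_37 good5_3 good5_4). Qed.

(** * Truncated transversal designs *)

Lemma good_gdd_5_8 j : 5 <= j <= 8 -> good_gdd j.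
Proof.
have g5 := good_gdd_check check_g5.
have g6 := good_gdd_check check_g6.
have g7 := good_gdd_check check_g7.
have g8 := good_gdd_check check_g8.
by case: j => [|[|[|[|[|[|[|[|[|j]]]]]]]]].
Qed.

Lemma good5_transversal (k m : nat) (f : nat -> nat -> nat) (u : nat -> nat) :
  5 <= k <= 8 -> (forall l c, f l c < m) ->
  (forall c c' l l', c < c' < k -> l < m * m -> l' < m * m ->
     f l c = f l' c -> f l c' = f l' c' -> l = l') ->
  (forall c, c < 5 -> u c = m) -> (forall c, c < k -> u c <= m) ->
  (forall c, c < k -> good5 (u c)) -> good5 (\sum_(c < k) u c).
Proof.
move=> /andP[k5 k8] flt finj uf ule gu e.
apply: (good_order_wilson k5 flt finj ule uf) => [j /andP[j5 jk]|c ck]; last exact: gu.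
by apply: good_gdd_5_8; rewrite j5 (leq_trans jk).
Qed.

(** The differences 1 to 6 between the first seven columns have no prime factor other than 2, 3 and
    5, so they are units modulo [m]; the slope is the eighth column. *)
Lemma good5_truncate m a b c : coprime m 30 -> 0 < m -> good5 m ->
  a <= m -> b <= m -> c <= m -> good5 a -> good5 b -> good5 c -> good5 (5 * m + a + b + c).
Proof.
move=> cop m0 gm am bm cm ga gb gc.
pose u i := nth m [:: m; m; m; m; m; a; b; c] i.
have -> : 5 * m + a + b + c = \sum_(i < 8) u i.
  by rewrite !big_ord_recl big_ord0 /u /=; lia.
apply: (@good5_transversal 8 m (linear_line 8 m)) => //.
- by move=> l i; apply: linear_line_lt.
- apply: linear_line_inj => // d /andP[d0 d7].
  have c2 : coprime m 2 by apply: coprime_dvdr cop.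
  have c3 : coprime m 3 by apply: coprime_dvdr cop.
  have c5 : coprime m 5 by apply: coprime_dvdr cop.
  have c4 : coprime m 4 by rewrite (_ : 4 = 2 * 2) // coprimeMr c2.
  have c6 : coprime m 6 by rewrite (_ : 6 = 2 * 3) // coprimeMr c2.
  by case: d d0 d7 => [|[|[|[|[|[|[|d]]]]]]] // _ _; rewrite coprimen1.
- by move=> i; rewrite /u; case: i => [|[|[|[|[|i]]]]].
- by move=> i; rewrite /u; case: i => [|[|[|[|[|[|[|[|i]]]]]]]].
- by move=> i; rewrite /u; case: i => [|[|[|[|[|[|[|[|i]]]]]]]].
Qed.

(** Modulo 5 only the differences 1 to 4 are units: five columns together with the slope, the latter
    being truncated. *)
Lemma good5_truncate5 a : a <= 5 -> good5 a -> good5 (25 + a).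
Proof.
move=> a5 ga; pose u i := nth 5 [:: 5; 5; 5; 5; 5; a] i.
have -> : 25 + a = \sum_(i < 6) u i by rewrite !big_ord_recl big_ord0 /u /=; lia.
apply: (@good5_transversal 6 5 (linear_line 6 5)) => //.
- by move=> l i; apply: linear_line_lt.
- by apply: linear_line_inj => // d; case: d => [|[|[|[|[|d]]]]].
- by move=> i; rewrite /u; case: i => [|[|[|[|[|i]]]]].
- by move=> i; rewrite /u; case: i => [|[|[|[|[|[|i]]]]]].
- by move=> i; rewrite /u; case: i => [|[|[|[|[|[|i]]]]]] // _; apply: good5_5.
Qed.

(** Here 57 = 6 * 9 + 3, from seven columns over the field with nine elements, the last one
    truncated to three points. *)
Lemma good5_57 : good5 57.
Proof.
pose u i := nth 9 [:: 9; 9; 9; 9; 9; 9; 3] i.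
have -> : 57 = \sum_(i < 7) u i by rewrite !big_ord_recl big_ord0.
apply: (@good5_transversal 7 9 gf9_line) => //.
- exact: gf9_line_lt.
- exact: gf9_line_inj.
- by move=> i; rewrite /u; case: i => [|[|[|[|[|i]]]]].
- by move=> i; rewrite /u; case: i => [|[|[|[|[|[|[|i]]]]]]].
- by move=> i; rewrite /u; case: i => [|[|[|[|[|[|[|i]]]]]]] // _;
    first [exact: good5_9 | exact: good5_3].
Qed.

(** * The induction on n *)

Lemma split3 m s : 7 <= m -> s <= 3 * m -> s != 1 -> s != 2 ->
  exists a b c, [/\ s = a + b + c, a <= m, b <= m, c <= m &
    [/\ (a == 0) || (3 <= a), (b == 0) || (3 <= b) & (c == 0) || (3 <= c)]].
Proof.
(* Columns are filled greedily. When this would leave 1 or 2 points for the next column, that column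
   takes 3 and the previous one gives up the difference; it keeps at least [m - 2] points, and
   [m >= 7] makes that admissible. *)
move=> m7 s3 s1 s2.
have [sm|sm] := leqP s m; first by exists s, 0, 0; repeat split; lia.
have [sm2|sm2] := leqP s (2 * m).
  have [le|lt] := leqP (m + 3) s; first by exists m, (s - m), 0; repeat split; lia.
  by exists (s - 3), 3, 0; repeat split; lia.
have [le|lt] := leqP (2 * m + 3) s; first by exists m, m, (s - 2 * m); repeat split; lia.
by exists m, (s - m - 3), 3; repeat split; lia.
Qed.

Lemma good5_step m n : 7 <= m -> coprime m 30 -> m < n -> 5 * m <= n <= 8 * m ->
  n != 5 * m + 1 -> n != 5 * m + 2 ->
  (forall i, i < n -> 3 <= i -> good5 i) -> good5 n.
Proof.
move=> m7 cop mn /andP[n5 n8] n1 n2 IH.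
have [] := @split3 m (n - 5 * m) m7; try lia.
move=> a [b [c [sE am bm cm [a3 b3 c3]]]].
have g i : i <= m -> (i == 0) || (3 <= i) -> good5 i.
  move=> im /orP[/eqP->|i3]; first exact: good5_0.
  by apply: IH i3; apply: leq_ltn_trans mn.
have -> : n = 5 * m + a + b + c by lia.
by apply: good5_truncate => //; first [lia | by apply: g | by apply: g => //; lia].
Qed.

(** Consecutive integers prime to 30 differ by at most 6, as between 1 and 7 or 23 and 29. *)
Lemma coprime30_below x : 6 <= x -> exists2 d, d < 6 & coprime (x - d) 30.
Proof.
move=> x6.
(* Adding 30 keeps the subtraction of [d] from being truncated. *)
have H : forall y, y < 30 -> exists2 d, d < 6 & coprime (y + 30 - d) 30.
  have : all (fun y => has (fun d => coprime (y + 30 - d) 30) (iota 0 6)) (iota 0 30) by [].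
  move=> + y y30.
  move=> /allP/(_ y); rewrite mem_iota => /(_ y30)/hasP[d]; rewrite mem_iota => d6 c.
  by exists d.
have [d d6 c] := H (x %% 30) (ltn_pmod x (isT : 0 < 30)).
exists d => //; rewrite -coprime_modl; rewrite -coprime_modl in c.
by rewrite (_ : (x - d) %% 30 = (x %% 30 + 30 - d) %% 30) //; lia.
Qed.

Lemma good5_lt38 n : 3 <= n -> n < 38 -> good5 n.
Proof.
move=> n3 n38; have : n \in iota 3 35 by rewrite mem_iota n3.
move: n3 n38 => _ _; rewrite [iota 3 35]/= !in_cons in_nil.
repeat (case/orP => [/eqP->|]); last by [].
all: first
  [ exact: good5_3 | exact: good5_4 | exact: good5_5 | exact: good5_6 | exact: good5_7
  | exact: good5_8 | exact: good5_9 | exact: good5_10 | exact: good5_11 | exact: good5_12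
  | exact: good5_13 | exact: good5_14 | exact: good5_15 | exact: good5_16 | exact: good5_17
  | exact: good5_18 | exact: good5_19 | exact: good5_20 | exact: good5_21 | exact: good5_22
  | exact: good5_23 | exact: good5_24 | exact: good5_26 | exact: good5_27 | exact: good5_31
  | exact: good5_32 | exact: good5_33 | exact: good5_34 | exact: good5_36 | exact: good5_37
  | exact: (@good5_truncate5 0 isT good5_0) | exact: (@good5_truncate5 3 isT good5_3)
  | exact: (@good5_truncate5 4 isT good5_4) | exact: (@good5_truncate5 5 isT good5_5)
  | exact: (@good5_truncate 7 0 0 0 isT isT good5_7 isT isT isT good5_0 good5_0 good5_0) ].
Qed.

(** The ranges are 38 to 56 for m = 7, 58 to 88 for m = 11 and 89 to 100 for m = 13; each of them
    avoids 5m + 1 and 5m + 2. Beyond, the intervals from 5m + 3 to 8m are long enough to absorb the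
    gaps between integers prime to 30. *)
Lemma good5_all n : 3 <= n -> good5 n.
Proof.
elim/ltn_ind: n => n IH n3.
have IH' i : i < n -> 3 <= i -> good5 i by move=> ? ?; apply: IH.
have [n38|n38] := ltnP n 38; first exact: good5_lt38.
have [->|n57] := eqVneq n 57; first exact: good5_57.
have [n57'|n57'] := ltnP n 57; first by apply: (@good5_step 7); lia || done.
have [n89|n89] := ltnP n 89; first by apply: (@good5_step 11); lia || done.
have [n101|n101] := ltnP n 101; first by apply: (@good5_step 13); lia || done.
(* The largest [m] with [5 * m + 3 <= n]. Going down by at most 5 to an integer prime to 30
   preserves [n <= 8 * m], since [n <= 5 * x + 7 <= 8 * (x - 5)] once [x >= 16], and here
   [x >= 19]. *)
pose x := (n - 3) %/ 5.
have xn : 5 * x + 3 <= n < 5 * x + 8 by rewrite /x; lia.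
have [d d6 cop] := @coprime30_below x ltac:(lia).
by apply: (@good5_step (x - d)) => //; lia.
Qed.

Theorem mainTheorem1 (v : nat) (hv : 15 <= v)
    (hmod : v = 0 %[mod 5] \/ v = 1 %[mod 5]) :
  exists D : DD 'I_v, super_simple D /\ (1 / 2 <= defining_ratio D :> rat)%R.
Proof.
have gv : good_order v.
  case: hmod => h; rewrite (divn_eq v 5) h mulnC /=.
    by apply: (@good5_all (v %/ 5) _ false); lia.
  by apply: (@good5_all (v %/ 5) _ true); lia.
have v1 : 1 < v by apply: leq_trans hv.
apply: (@good_design _ (Ordinal (ltnW v1)) (Ordinal v1)) => //.
have gE : good (fun x y : 'I_v => (x \in enum 'I_v) && (y \in enum 'I_v)).
  by apply: good_on_seq; rewrite ?enum_uniq // size_enum_ord.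
by apply: eq_good gE => x y xy; rewrite !mem_enum xy.
Qed.
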